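(* Let $\tilde M^{n+k+1}$ be an $(n+k+1)$-dimensional Riemannian manifold with a nowhere vanishing closed conformal vector field $\xi$ with conformal factor $\psi_\xi$, let $\Xi^{n+k}$ be a leaf of the distribution $\xi^\bot$, let $M^n$ be a compact Riemannian manifold and $\varphi:M^n\to\Xi^{n+k}$ an isometric immersion. Let $\Psi$ be the flow of $\xi$ and let $\epsilon>0$ be such that $\Psi$ is defined on $(-\epsilon,\epsilon)\times\varphi(M)$ and the map $$\Phi:(-\epsilon,\epsilon)\times M^n\to\tilde M^{n+k+1},\qquad \Phi(t,q)=\Psi(t,\varphi(q)),$$ is an immersion; furnish $(-\epsilon,\epsilon)\times M^n$ with the metric induced by $\Phi$. Assume $\psi_\xi\neq0$ on $\varphi(M)$. If $\tilde M$ has constant sectional curvature or $\mathrm{Ric}_{\tilde M}(\xi)=0$, then the following are equivalent: (a) $\varphi$ is minimal. (b) $\Phi$ is minimal. (c) $\Phi$ has parallel mean curvature.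
   Context: Let $\tilde\nabla$ be the Levi-Civita connection of $\tilde M$. A smooth vector field $\xi$ is closed conformal with conformal factor the smooth function $\psi_\xi$ if $\tilde\nabla_X\xi=\psi_\xi X$ for all vector fields $X$. The distribution $\xi^\bot$ of vectors orthogonal to $\xi$ is then integrable; a leaf is a maximal connected integral hypersurface, with the induced metric. $\mathrm{Ric}_{\tilde M}$ denotes the field of self-adjoint operators associated to the Ricci tensor of $\tilde M$, so $\langle\mathrm{Ric}_{\tilde M}(X),Y\rangle$ is the Ricci tensor evaluated at $(X,Y)$. ''$\varphi$ is minimal'' means that $\varphi$ has zero mean curvature vector as an immersion into $\Xi$; ''$\Phi$ is minimal'' means zero mean curvature vector in $\tilde M$; ''$\Phi$ has parallel mean curvature'' means its mean curvature vector is parallel with respect to the normal connection of $\Phi$. By compactness of $M$, an $\epsilon$ as in the claim always exists. *)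

(* Defs.v *)
From HB Require Import structures.
From mathcomp Require Import all_boot all_order all_algebra.
From mathcomp Require Import all_classical all_reals all_analysis.

Set Implicit Arguments.
Unset Strict Implicit.
Unset Printing Implicit Defensive.
Import Order.TTheory GRing.Theory Num.Theory.
Import numFieldNormedType.Exports.
Local Open Scope classical_set_scope.
Local Open Scope ring_scope.

(* Geometry is written in coordinates: a manifold is a topological space with
   an indexed smooth atlas, a tensor field is the family of its components in
   the charts, subject to the transformation law, and a point of a chart is a
   row vector, so that 'd f x u = u *m 'J f x. *)

Fixpoint Ck_on (R : realType) (m : nat) (V : normedModType R) (r : nat)
    (U : set 'rV[R]_m) (f : 'rV[R]_m -> V) : Prop :=
  if r is r'.+1 then
    (forall x, U x -> differentiable f x) /\
    (forall v, Ck_on r' U (fun x => 'D_v f x))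
  else forall x, U x -> {for x, continuous f}.

(* C^oo; only meant for U open *)
Definition smooth_on (R : realType) (m : nat) (V : normedModType R)
    (U : set 'rV[R]_m) (f : 'rV[R]_m -> V) : Prop :=
  forall r, Ck_on r U f.

Record atlas_space (R : realType) (m : nat) := AtlasSpace {
  pts :> topologicalType ;
  chart : Type ;
  cdom : chart -> set pts ;
  cmap : chart -> pts -> 'rV[R]_m ;
  cinv : chart -> 'rV[R]_m -> pts }.

Definition ccod (R : realType) (m : nat) (X : atlas_space R m) (i : chart X) :
    set 'rV[R]_m := cmap i @` cdom i.

Definition rep (R : realType) (m l : nat) (X : atlas_space R m)
    (Y : atlas_space R l) (f : X -> Y) (i : chart X) (j : chart Y) :
    'rV[R]_m -> 'rV[R]_l := fun x => cmap j (f (cinv i x)).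

Definition repdom (R : realType) (m l : nat) (X : atlas_space R m)
    (Y : atlas_space R l) (f : X -> Y) (i : chart X) (j : chart Y) :
    set 'rV[R]_m := [set x | ccod i x /\ cdom j (f (cinv i x))].

Record manifold (R : realType) (m : nat) (X : atlas_space R m) : Prop :=
  Manifold {
    mfd_hausdorff : hausdorff_space X ;
    mfd_second_countable : @second_countable X ;
    mfd_cover : forall p : X, exists i : chart X, cdom i p ;
    mfd_open_dom : forall i : chart X, open (cdom i) ;
    mfd_open_cod : forall i : chart X, open (ccod i) ;
    mfd_cmapK : forall (i : chart X) (p : X), cdom i p -> cinv i (cmap i p) = p ;
    mfd_cmap_cont : forall (i : chart X) (p : X),
      cdom i p -> {for p, continuous (cmap i)} ;
    mfd_cinv_cont : forall (i : chart X) (x : 'rV[R]_m),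
      ccod i x -> {for x, continuous (cinv i)} ;
    mfd_trans : forall i j : chart X,
      smooth_on (repdom (fun p : X => p) i j) (rep (fun p : X => p) i j) }.

(* ]-e, e[ x X as an open submanifold of R x X: the points (t, q) of R x X
   with t outside ]-e, e[ belong to no chart, and every notion below only
   looks at points that belong to a chart. *)
Definition cylinder (R : realType) (m : nat) (e : R) (X : atlas_space R m) :
    atlas_space R (1 + m) :=
  @AtlasSpace R (1 + m) (R * X)%type (chart X)
    (fun i => [set p : R * X | [/\ - e < p.1, p.1 < e & cdom i p.2]])
    (fun i p => row_mx p.1%:M (cmap i p.2))
    (fun i x => (lsubmx x 0 0, cinv i (rsubmx x))).

(* Continuity is required explicitly, so that repdom f i j is open. *)
Definition smooth_map (R : realType) (m l : nat) (X : atlas_space R m)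
    (Y : atlas_space R l) (f : X -> Y) : Prop :=
  (forall (i : chart X) (p : X), cdom i p -> {for p, continuous f}) /\
  (forall (i : chart X) (j : chart Y), smooth_on (repdom f i j) (rep f i j)).

Definition smooth_fun (R : realType) (m : nat) (X : atlas_space R m)
    (h : X -> R) : Prop :=
  forall i : chart X, smooth_on (ccod i) (fun x => h (cinv i x) : R^o).

Definition immersion (R : realType) (m l : nat) (X : atlas_space R m)
    (Y : atlas_space R l) (f : X -> Y) : Prop :=
  smooth_map f /\
  (forall (i : chart X) (j : chart Y) (x : 'rV[R]_m), repdom f i j x ->
     forall u : 'rV[R]_m, 'd (rep f i j) x u = 0 -> u = 0).

Definition vfield (R : realType) (m : nat) (X : atlas_space R m) : Type :=
  chart X -> 'rV[R]_m -> 'rV[R]_m.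

Definition smooth_vfield (R : realType) (m : nat) (X : atlas_space R m)
    (xi : vfield X) : Prop :=
  (forall i : chart X, smooth_on (ccod i) (xi i)) /\
  (forall (i j : chart X) (x : 'rV[R]_m), repdom (fun p : X => p) i j x ->
     xi j (rep (fun p : X => p) i j x) =
     'd (rep (fun p : X => p) i j) x (xi i x)).

Definition metric (R : realType) (m : nat) (X : atlas_space R m) : Type :=
  chart X -> 'rV[R]_m -> 'M[R]_m.

Definition inner (R : realType) (m : nat) (A : 'M[R]_m) (u v : 'rV[R]_m) : R :=
  (u *m A *m v^T) 0 0.

Definition induced_metric (R : realType) (m l : nat) (X : atlas_space R m)
    (Y : atlas_space R l) (f : X -> Y) (gY : metric Y) (gX : metric X) : Prop :=
  forall (i : chart X) (j : chart Y) (x : 'rV[R]_m), repdom f i j x ->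
    gX i x = 'J (rep f i j) x *m gY j (rep f i j x) *m ('J (rep f i j) x)^T.

Record riemannian_metric (R : realType) (m : nat) (X : atlas_space R m)
    (g : metric X) : Prop := RiemannianMetric {
  rm_smooth : forall i : chart X, smooth_on (ccod i) (g i) ;
  rm_sym : forall (i : chart X) (x : 'rV[R]_m), ccod i x -> (g i x)^T = g i x ;
  rm_pos : forall (i : chart X) (x : 'rV[R]_m), ccod i x ->
    forall u : 'rV[R]_m, u != 0 -> 0 < inner (g i x) u u ;
  rm_trans : induced_metric (fun p : X => p) g g }.

Definition isometric_immersion (R : realType) (m l : nat) (X : atlas_space R m)
    (gX : metric X) (Y : atlas_space R l) (gY : metric Y) (f : X -> Y) : Prop :=
  immersion f /\ induced_metric f gY gX.

Definition basis_vec (R : realType) (m : nat) (i : 'I_m) : 'rV[R]_m :=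
  delta_mx 0 i.

(* Row vector of the symbols Gamma_ij^k =
   1/2 sum_l g^kl (d_i g_jl + d_j g_il - d_l g_ij) of the Levi-Civita
   connection of the metric G on an open subset of R^m. *)
Definition christoffel (R : realType) (m : nat) (G : 'rV[R]_m -> 'M[R]_m)
    (x : 'rV[R]_m) (i j : 'I_m) : 'rV[R]_m :=
  (2^-1 *: \row_l ('D_(basis_vec R i) (fun y => G y j l : R^o) x
                 + 'D_(basis_vec R j) (fun y => G y i l : R^o) x
                 - 'D_(basis_vec R l) (fun y => G y i j : R^o) x))
  *m invmx (G x).

Definition Gamma (R : realType) (m : nat) (G : 'rV[R]_m -> 'M[R]_m)
    (x u v : 'rV[R]_m) : 'rV[R]_m :=
  \sum_(i < m) \sum_(j < m) (u 0 i * v 0 j) *: christoffel G x i j.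

(* nabla_u V for a vector field V along F : R^n -> R^m; for F the identity
   this is the Levi-Civita connection of G. *)
Definition covd (R : realType) (n m : nat) (G : 'rV[R]_m -> 'M[R]_m)
    (F : 'rV[R]_n -> 'rV[R]_m) (V : 'rV[R]_n -> 'rV[R]_m)
    (x u : 'rV[R]_n) : 'rV[R]_m :=
  'D_u V x + Gamma G (F x) ('d F x u) (V x).

(* R(u, v) w = nabla_u nabla_v w - nabla_v nabla_u w for constant u, v, w *)
Definition curv (R : realType) (m : nat) (G : 'rV[R]_m -> 'M[R]_m)
    (x u v w : 'rV[R]_m) : 'rV[R]_m :=
  covd G id (fun y => covd G id (fun _ => w) y v) x u
  - covd G id (fun y => covd G id (fun _ => w) y u) x v.

Definition sectional (R : realType) (m : nat) (G : 'rV[R]_m -> 'M[R]_m)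
    (x u v : 'rV[R]_m) : R :=
  inner (G x) (curv G x u v v) u /
  (inner (G x) u u * inner (G x) v v - inner (G x) u v ^+ 2).

Definition ricci (R : realType) (m : nat) (G : 'rV[R]_m -> 'M[R]_m)
    (x u v : 'rV[R]_m) : R :=
  \sum_(l < m) curv G x (basis_vec R l) u v 0 l.

(* the vector with inner (G x) (ricci_op G x u) v = ricci G x u v *)
Definition ricci_op (R : realType) (m : nat) (G : 'rV[R]_m -> 'M[R]_m)
    (x u : 'rV[R]_m) : 'rV[R]_m :=
  (\row_l ricci G x u (basis_vec R l)) *m invmx (G x).

(* F is an immersion of an open subset of R^n, with metric H = F^* G, and w is
   a vector of R^m at F x. *)
Definition normal_part (R : realType) (n m : nat) (G : 'rV[R]_m -> 'M[R]_m)
    (F : 'rV[R]_n -> 'rV[R]_m) (H : 'rV[R]_n -> 'M[R]_n)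
    (x : 'rV[R]_n) (w : 'rV[R]_m) : 'rV[R]_m :=
  w - \sum_(i < n) \sum_(j < n)
        (invmx (H x) i j * inner (G (F x)) w ('d F x (basis_vec R i)))
          *: 'd F x (basis_vec R j).

Definition second_form (R : realType) (n m : nat) (G : 'rV[R]_m -> 'M[R]_m)
    (F : 'rV[R]_n -> 'rV[R]_m) (H : 'rV[R]_n -> 'M[R]_n)
    (x u v : 'rV[R]_n) : 'rV[R]_m :=
  normal_part G F H x (covd G F (fun y => 'd F y v) x u).

Definition mean_curv (R : realType) (n m : nat) (G : 'rV[R]_m -> 'M[R]_m)
    (F : 'rV[R]_n -> 'rV[R]_m) (H : 'rV[R]_n -> 'M[R]_n)
    (x : 'rV[R]_n) : 'rV[R]_m :=
  n%:R^-1 *: \sum_(i < n) \sum_(j < n)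
    invmx (H x) i j *: second_form G F H x (basis_vec R i) (basis_vec R j).

Definition normal_covd (R : realType) (n m : nat) (G : 'rV[R]_m -> 'M[R]_m)
    (F : 'rV[R]_n -> 'rV[R]_m) (H : 'rV[R]_n -> 'M[R]_n)
    (V : 'rV[R]_n -> 'rV[R]_m) (x u : 'rV[R]_n) : 'rV[R]_m :=
  normal_part G F H x (covd G F V x u).

Definition constant_sectional_curvature (R : realType) (m : nat)
    (X : atlas_space R m) (g : metric X) : Prop :=
  exists c : R, forall (i : chart X) (x u v : 'rV[R]_m), ccod i x ->
    row_free (col_mx u v) -> sectional (g i) x u v = c.

Definition ricci_null (R : realType) (m : nat) (X : atlas_space R m)
    (g : metric X) (xi : vfield X) : Prop :=
  forall (i : chart X) (x : 'rV[R]_m), ccod i x -> ricci_op (g i) x (xi i x) = 0.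

Definition closed_conformal (R : realType) (m : nat) (X : atlas_space R m)
    (g : metric X) (xi : vfield X) (psi : X -> R) : Prop :=
  [/\ smooth_vfield xi, smooth_fun psi &
   forall (i : chart X) (x : 'rV[R]_m), ccod i x ->
     forall u : 'rV[R]_m, covd (g i) id (xi i) x u = psi (cinv i x) *: u].

Definition nowhere_vanishing (R : realType) (m : nat) (X : atlas_space R m)
    (xi : vfield X) : Prop :=
  forall (i : chart X) (x : 'rV[R]_m), ccod i x -> xi i x != 0.

Definition minimal (R : realType) (m l : nat) (X : atlas_space R m)
    (gX : metric X) (Y : atlas_space R l) (gY : metric Y) (f : X -> Y) : Prop :=
  forall (i : chart X) (j : chart Y) (x : 'rV[R]_m), repdom f i j x ->
    mean_curv (gY j) (rep f i j) (gX i) x = 0.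

Definition parallel_mean_curvature (R : realType) (m l : nat)
    (X : atlas_space R m) (gX : metric X) (Y : atlas_space R l)
    (gY : metric Y) (f : X -> Y) : Prop :=
  forall (i : chart X) (j : chart Y) (x : 'rV[R]_m), repdom f i j x ->
    forall u : 'rV[R]_m,
    normal_covd (gY j) (rep f i j) (gX i)
      (mean_curv (gY j) (rep f i j) (gX i)) x u = 0.

(* A connected integral manifold of the distribution orthogonal to xi, as an
   injectively immersed manifold: its topology may be finer than the one
   induced by X. *)
Definition integral_manifold (R : realType) (m d : nat) (X : atlas_space R m)
    (g : metric X) (xi : vfield X) (L : atlas_space R d) (iota : L -> X) : Prop :=
  [/\ manifold L, connected [set: L], immersion iota, injective iota &
   forall (i : chart L) (j : chart X) (x : 'rV[R]_d), repdom iota i j x ->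
     forall w : 'rV[R]_m,
       (exists u : 'rV[R]_d, 'd (rep iota i j) x u = w) <->
       inner (g j (rep iota i j x)) w (xi j (rep iota i j x)) = 0].

Definition leaf (R : realType) (m d : nat) (X : atlas_space R m)
    (g : metric X) (xi : vfield X) (L : atlas_space R d) (iota : L -> X) : Prop :=
  integral_manifold g xi iota /\
  (forall (N : atlas_space R d) (f : N -> X), integral_manifold g xi f ->
     range iota `<=` range f -> range f `<=` range iota).

Definition integral_curve (R : realType) (m : nat) (X : atlas_space R m)
    (xi : vfield X) (J : set R) (c : R -> X) : Prop :=
  forall t : R, J t -> {for t, continuous c} /\
    (forall i : chart X, cdom i (c t) ->
       is_derive (t : R^o) (1 : R^o) (fun s : R^o => cmap i (c s))
         (xi i (cmap i (c t)))).

(* Psi is the maximal flow of xi; D p is the interval on which the maximal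
   integral curve t |-> Psi t p through p is defined. *)
Definition flow (R : realType) (m : nat) (X : atlas_space R m)
    (xi : vfield X) (D : X -> set R) (Psi : R -> X -> X) : Prop :=
  forall p : X,
    [/\ open (D p), is_interval (D p), D p 0, Psi 0 p = p &
        integral_curve xi (D p) (Psi^~ p)] /\
    (forall (J : set R) (c : R -> X), open J -> is_interval J -> J 0 ->
       c 0 = p -> integral_curve xi J c ->
       J `<=` D p /\ (forall t, J t -> c t = Psi t p)).

Definition flow_map (R : realType) (n m : nat) (eps : R) (M : atlas_space R n)
    (X : atlas_space R m) (Psi : R -> X -> X) (f : M -> X) :
    cylinder eps M -> X := fun p => Psi p.1 (f p.2).

(* Main.v *)
(* Write F = Phi(t, x) in charts, so that d_t F = xi(F), and let h be the induced
   metric and H the mean curvature vector of Phi.  From nabla xi = psi Id one gets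
   L_xi g = 2 psi g, hence d_t h = 2 psi h, and d psi is proportional to <xi, .>.
   Differentiating L_xi g = 2 psi g once more gives, for w normal to Phi,
   <nabla_t nabla_a F_b, w> = psi <nabla_a F_b, w>, so that
   <nabla_t H, H> = - psi |H|^2.  Two consequences follow.
   - If H is parallel, then psi |H|^2 = 0, and H = 0 at t = 0 because psi <> 0 there.
   - |H|^2 h(d_t, d_t) is constant along the lines t |-> (t, q), so H vanishes on a
     whole line as soon as it vanishes at one point of it.
   At t = 0 the second fundamental form of the leaf takes values in the multiples
   of xi, which is tangent to Phi; so the Gauss formula for the leaf shows that H
   vanishes there iff phi is minimal.  An isometry maps mean curvature to mean
   curvature, by the Koszul formula, so the charts play no role. *)

Require Import Defs.
From HB Require Import structures.
From mathcomp Require Import all_boot all_order all_algebra.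
From mathcomp Require Import all_classical all_reals all_analysis.
From mathcomp Require Import perm ring lra.
Import Order.TTheory GRing.Theory Num.Theory.
Import numFieldNormedType.Exports.
Local Open Scope classical_set_scope.
Local Open Scope ring_scope.
Set Implicit Arguments.
Unset Strict Implicit.
Unset Printing Implicit Defensive.

(** Vectors are handled through their pairings: testing against [w] removes the inverse metric from
    the Christoffel symbols and turns identities of connections into linear relations between real
    numbers; nondegeneracy recovers a vector identity where one is needed. The rate [- psi] in the
    derivative of H is [- 2 psi] from the inverse induced metric plus [psi] from the second
    fundamental form; the terms in d psi drop out because H is orthogonal to every d_a F, among them
    d_t F = xi. The projection that makes H normal depends on t as well, but nabla_t d_a F = psi d_a
    F keeps the derivative of its correction tangent. The factor h(d_t, d_t) = |xi|^2 acts as an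
    integrating factor: its rate [2 psi] is opposite to that of |H|^2, so zeros propagate by the
    mean value theorem, with no uniqueness theorem for linear differential equations. The metrics of
    the leaf and of the cylinder are known through pullback formulas, from which the regularity and
    definiteness required of them are extracted. *)

(** * Directional derivatives of composites, products and matrices *)

Section Calculus.
Variable R : realType.

(** [g] has a derivative in the direction [v] and may be irregular otherwise: restricted to the line
    through [x] it is a function of one real variable, where derivable and differentiable agree. *)
Lemma is_derive_comp (U V W : normedModType R) (f : V -> W) (g : U -> V)
    (x v : U) (dg : V) :
  differentiable f (g x) -> is_derive x v g dg ->
  is_derive x v (fun y => f (g y)) ('d f (g x) dg).
Proof.
move=> df [dg1 dg2].
pose c := fun h : R => g (h *: v + x).
have c0 : c 0 = g x by rewrite /c scale0r add0r.
have dc : differentiable c 0.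
  by apply/derivable1_diffP; exact: (derivable1P g x v).1.
have dfc : differentiable f (c 0) by rewrite c0.
have dE (V' : normedModType R) (k : V -> V') : 'D_v (fun y => k (g y)) x = 'D_1 (k \o c) 0.
  rewrite /derive (_ : (fun h => _) =
    fun h : R => h^-1 *: ((k \o c \o shift 0) (h *: 1) - (k \o c) 0))//.
  by apply: funext => h /=; rewrite c0 addr0 [h *: 1]mulr1.
have dgv : 'D_v g x = 'D_1 c 0 := dE _ id.
have dfg := dE _ f.
have dcomp : differentiable (f \o c) 0 by exact: differentiable_comp.
apply: DeriveDef.
  by apply/derivable1P; exact: (derivable1_diffP (f \o c) 0).2.
by rewrite dfg -dg2 dgv !deriveE// diff_comp//= c0.
Qed.

Lemma is_derive_diff (V W : normedModType R) (f : V -> W) (x v : V) :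
  differentiable f x -> is_derive x v f ('d f x v).
Proof.
move=> df; apply: DeriveDef; first exact: diff_derivable.
by rewrite deriveE.
Qed.

Lemma is_derive_mx (V : normedModType R) (a b : nat) (A : V -> 'M[R]_(a, b))
    (dA : 'M[R]_(a, b)) (x v : V) :
  (forall i j, is_derive x v (fun y => A y i j : R^o) (dA i j)) <->
  is_derive x v A dA.
Proof.
split=> [H|[H <-] i j].
  have dA1 : derivable A x v.
    by apply/derivable_mxP => i j; have [] := H i j.
  apply: DeriveDef => //; rewrite derive_mx//; apply/matrixP => i j.
  by rewrite mxE; have [] := H i j.
apply: DeriveDef; first by move/derivable_mxP : H; apply.
by rewrite derive_mx// mxE.
Qed.

Lemma is_derive_sumr (V W : normedModType R) (I : finType) (f : I -> V -> W)
    (df : I -> W) (x v : V) :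
  (forall i, is_derive x v (f i) (df i)) ->
  is_derive x v (fun y => \sum_i f i y) (\sum_i df i).
Proof.
move=> H.
rewrite (_ : (fun y => _) = \sum_i f i); last first.
  by apply: funext => y; rewrite fct_sumE.
by elim/big_ind2 : _ => // [|] *; [exact: is_derive_cst|exact: is_deriveD].
Qed.

Lemma is_derive_scale (V W : normedModType R) (c : V -> R^o) (f : V -> W)
    (dc : R) (df : W) (x v : V) :
  is_derive x v c dc -> is_derive x v f df ->
  is_derive x v (fun y => c y *: f y) (dc *: f x + c x *: df).
Proof.
move=> [c1 <-] [f1 <-].
have H : (fun h : R => h^-1 *: (c (h *: v + x) *: f (h *: v + x) - c x *: f x)) @ 0^' -->
   'D_v c x *: f x + c x *: 'D_v f x.
  rewrite (_ : (fun h => _) = (fun h : R => (h^-1 *: (c (h *: v + x) - c x)) *: f x +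
     c (h *: v + x) *: (h^-1 *: (f (h *: v + x) - f x)))); last first.
    apply: funext => h; set c' := c (h *: v + x); set f' := f (h *: v + x).
    rewrite -[h^-1 *: (c' - c x)]/(h^-1 * (c' - c x)) -scalerA.
    rewrite [c' *: (_ *: _)]scalerA mulrC -scalerA -scalerDr; congr (_ *: _).
    by rewrite scalerBl scalerBr [RHS]addrC subrKA.
  apply: cvgD.
    apply: cvgZr_tmp; exact: c1.
  apply: cvgZ; last exact: f1.
  (* Only continuity of [c] along the line is available, since [c] is derivable in one direction. *)
  pose c' := fun h : R => c (h *: v + x).
  have dc' : differentiable c' 0.
    by apply/derivable1_diffP; exact: (derivable1P c x v).1.
  have Hc : c' @ (0 : R) --> c' 0 := differentiable_continuous dc'.
  rewrite {2}/c' scale0r add0r in Hc; apply: cvg_trans Hc.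
  by apply: cvg_app; exact: cvg_within.
by apply: DeriveDef; [apply/cvg_ex; eexists; exact: H|exact: cvg_lim H].
Qed.

Lemma is_derive_mulmx (V : normedModType R) (a b c : nat)
    (A : V -> 'M[R]_(a, b)) (B : V -> 'M[R]_(b, c)) dA dB (x v : V) :
  is_derive x v A dA -> is_derive x v B dB ->
  is_derive x v (fun y => A y *m B y) (dA *m B x + A x *m dB).
Proof.
move=> /is_derive_mx hA /is_derive_mx hB; apply/is_derive_mx => i j.
rewrite (_ : (fun y => _) = fun y => \sum_k (A y i k * B y k j)); last first.
  by apply: funext => y; rewrite mxE.
rewrite !mxE -big_split /=; apply: is_derive_sumr => k.
exact: (is_derive_scale (hA i k) (hB k j)).
Qed.

Lemma is_derive_trmx (V : normedModType R) (a b : nat)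
    (A : V -> 'M[R]_(a, b)) dA (x v : V) :
  is_derive x v A dA -> is_derive x v (fun y => (A y)^T) dA^T.
Proof.
move=> /is_derive_mx hA; apply/is_derive_mx => i j.
rewrite mxE (_ : (fun y => _) = fun y => A y j i)//.
by apply: funext => y; rewrite mxE.
Qed.

Lemma is_derive_inner (V : normedModType R) (m : nat) (A : V -> 'M[R]_m)
    (f h : V -> 'rV[R]_m) dA df dh (x v : V) :
  is_derive x v A dA -> is_derive x v f df -> is_derive x v h dh ->
  is_derive x v (fun y => inner (A y) (f y) (h y) : R^o)
    (inner dA (f x) (h x) + inner (A x) df (h x) + inner (A x) (f x) dh).
Proof.
move=> hA hf hh.
have := is_derive_mulmx (is_derive_mulmx hf hA) (is_derive_trmx hh).
move=> /is_derive_mx/(_ 0 0) /is_derive_eq; apply.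
by rewrite /inner mulmxDl !mxE [X in X + _ = _]addrC.
Qed.

End Calculus.

(** * Symmetry of second derivatives *)

Section Young.
Variable R : realType.

Lemma is_derive_line (V W : normedModType R) (f : V -> W) (u y : V) (a : R)
    (d : W) :
  is_derive (a *: u + y) u f d <->
  is_derive (a : R^o) (1 : R^o) (fun b : R^o => f (b *: u + y)) d.
Proof.
have E : (fun h : R => h^-1 *: ((f \o shift (a *: u + y)) (h *: u) - f (a *: u + y)))
  = (fun h : R => h^-1 *: (((fun b : R^o => f (b *: u + y)) \o shift (a : R^o))
        (h *: (1 : R^o)) - f (a *: u + y))).
  by apply: funext => h /=; rewrite [h *: 1]mulr1 scalerDl addrA.
split=> -[].
  by rewrite /derivable /derive E; exact: DeriveDef.
by rewrite /derivable /derive -E; exact: DeriveDef.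
Qed.

Lemma diff_nearP (V W : normedModType R) (f : V -> W) (x : V) (e : R) :
  0 < e -> differentiable f x ->
  \forall h \near (0 : V), `|f (h + x) - f x - 'd f x h| <= e * `|h|.
Proof.
move=> e0 /diff_locally/eqaddoP/(_ _ e0); apply: filterS => h /=.
by rewrite opprD addrA.
Qed.

(** The mean value theorem in the direction [u] turns the second difference into [s] times a
    difference of two values of [fu]; expanding both at [x] leaves [s] times the derivative of [fu]
    along [v]. *)
Lemma second_difference_bound (V : normedModType R) (f fu : V -> R^o) (x u v : V) :
  (\forall y \near x, is_derive y u f (fu y)) -> differentiable fu x ->
  forall e : R, 0 < e -> \forall s \near 0^'+,
  `|f (s *: u + (s *: v + x)) - f (s *: u + x) - f (s *: v + x) + f x
    - s ^+ 2 * 'D_v fu x| <= e * s ^+ 2.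
Proof.
(* The two displacements at which [fu] is expanded have total length at most [s * (2 * |u| + |v|)],
   so errors of relative size [e / k] add up to at most [e * s]; the [+ 1] keeps [k] positive. *)
move=> hfu dfu e e0; pose L := 'd fu x; pose k := 2 * `|u| + `|v| + 1.
have k0 : 0 < k by rewrite ltr_wpDl// addr_ge0// mulr_ge0.
have e'0 : 0 < e / k by rewrite divr_gt0.
have /nbhs_ballP[d1 /= d10 hd1] := diff_nearP e'0 dfu.
have /nbhs_ballP[d2 /= d20 hd2] := hfu.
pose d := Num.min d1 d2; have d0 : 0 < d by rewrite lt_min d10.
have {}hd1 h : `|h| < d -> `|fu (h + x) - fu x - L h| <= e / k * `|h|.
  move=> hd; apply: hd1; rewrite -ball_normE /= sub0r normrN.
  by rewrite (lt_le_trans hd)// ge_min lexx.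
have {}hd2 h : `|h| < d -> is_derive (h + x) u f (fu (h + x)).
  move=> hd; apply: hd2; rewrite -ball_normE /= opprD addrCA subrr addr0 normrN.
  by rewrite (lt_le_trans hd)// ge_min lexx orbT.
near=> s.
have s0 : 0 < s by near: s; exact: nbhs_right_gt.
have sk : s * k < d.
  by rewrite -ltr_pdivlMr//; near: s; apply: nbhs_right_lt; rewrite divr_gt0.
have su (a : R) : 0 <= a <= s -> `|a *: u| <= s * `|u|.
  by move=> /andP[a0 as_]; rewrite normrZ ger0_norm// ler_wpM2r.
have suv (a : R) : 0 <= a <= s -> `|a *: u + s *: v| <= s * (`|u| + `|v|).
  move=> /su as_; rewrite (le_trans (ler_normD _ _))// mulrDr lerD//.
  by rewrite normrZ gtr0_norm.
have kuv : s * (`|u| + `|v|) < d.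
  rewrite (le_lt_trans _ sk)// ler_pM2l// /k.
  by have := normr_ge0 u; lra.
have ku : s * `|u| < d.
  rewrite (le_lt_trans _ sk)// ler_pM2l// /k.
  by have := normr_ge0 u; have := normr_ge0 v; lra.
pose g := fun a : R => f (a *: u + (s *: v + x)) - f (a *: u + x).
pose dg := fun a : R => fu (a *: u + (s *: v + x)) - fu (a *: u + x).
have gd (a : R) : 0 <= a <= s -> is_derive (a : R^o) (1 : R^o) (g : R^o -> R^o) (dg a).
  move=> as_.
  have d1' : is_derive (a *: u + (s *: v + x)) u f (fu (a *: u + (s *: v + x))).
    by rewrite addrA; apply: hd2; apply: le_lt_trans (suv _ as_) kuv.
  have d2' : is_derive (a *: u + x) u f (fu (a *: u + x)).
    by apply: hd2; apply: le_lt_trans (su _ as_) ku.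
  have h1 := (is_derive_line f u (s *: v + x) a _).1 d1'.
  have h2 := (is_derive_line f u x a _).1 d2'.
  exact: (is_deriveB h1 h2).
have [||c cs] := @MVT R g dg 0 s s0.
- by move=> a; rewrite in_itv /= => /andP[a0 as_]; apply: gd; rewrite !ltW.
- apply: derivable_within_continuous => a; rewrite in_itv /= => as_.
  by have [] := gd _ as_.
have {}cs : 0 <= c <= s by move: cs; rewrite in_itv /= => /andP[a0 as_]; rewrite !ltW.
rewrite subr0 {1 2}/g scale0r !add0r => E.
rewrite (_ : _ + f x - _ = dg c * s - s ^+ 2 * 'D_v fu x); last first.
  by rewrite -E; ring.
have h1 := hd1 _ (le_lt_trans (suv _ cs) kuv).
have h2 := hd1 _ (le_lt_trans (su _ cs) ku).
have Lv : 'D_v fu x = L v by rewrite deriveE.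
have Ls : L (c *: u + s *: v) = L (c *: u) + s * L v.
  by rewrite /L linearD [X in _ + X]linearZ.
rewrite Ls in h1.
rewrite (_ : _ - _ = s * ((fu (c *: u + s *: v + x) - fu x - (L (c *: u) + s * L v))
   - (fu (c *: u + x) - fu x - L (c *: u)))); last first.
  by rewrite Lv /dg addrA; ring.
rewrite normrM (gtr0_norm s0) expr2 mulrCA ler_pM2l//.
rewrite (le_trans (ler_normB _ _))// (le_trans (lerD h1 h2))//.
rewrite -mulrDr -mulrA ler_pM2l// ler_pdivrMl//.
rewrite (le_trans (lerD (suv _ cs) (su _ cs)))// -mulrDr mulrC ler_pM2r// /k.
by have := normr_ge0 u; have := normr_ge0 v; lra.
Unshelve. all: by end_near. Qed.

Lemma second_difference_symmetric (a b c d p q s e : R) : 0 < s ->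
  `|a - b - c + d - s ^+ 2 * p| <= e / 2 * s ^+ 2 ->
  `|a - c - b + d - s ^+ 2 * q| <= e / 2 * s ^+ 2 -> `|p - q| <= e.
Proof.
move=> s0; have : 0 < s ^+ 2 by rewrite exprn_gt0.
move: (s ^+ 2) => t t0; rewrite !ler_norml => /andP[h1 h2] /andP[h3 h4].
by apply/andP; split; rewrite -(ler_pM2l t0); lra.
Qed.

(** One second difference, symmetric in [u] and [v], approximates [s ^+ 2] times either side;
    dividing by [s ^+ 2] brings the two sides within any [e]. *)
Lemma derive_swap (V : normedModType R) (f fu fv : V -> R^o) (x u v : V) :
  (\forall y \near x, is_derive y u f (fu y)) ->
  (\forall y \near x, is_derive y v f (fv y)) ->
  differentiable fu x -> differentiable fv x ->
  'D_v fu x = 'D_u fv x.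
Proof.
move=> hfu hfv dfu dfv; apply/eqP; rewrite -subr_eq0 -normr_le0.
apply/ler_addgt0Pl => e e0; rewrite addr0.
have e2 : 0 < e / 2 by rewrite divr_gt0.
have y1 := second_difference_bound v hfu dfu e2.
have y2 := second_difference_bound u hfv dfv e2.
have [s [s0 [h1 h2]]] := filter_ex (filterI (nbhs_right_gt (0 : R)) (filterI y1 y2)).
by rewrite addrCA in h2; exact: second_difference_symmetric s0 h1 h2.
Qed.

End Young.

(** * Second derivatives of smooth maps *)

Section Smooth.
Variable R : realType.

Lemma smooth_on_differentiable (p : nat) (W : normedModType R)
    (U : set 'rV[R]_p) (f : 'rV[R]_p -> W) x :
  smooth_on U f -> U x -> differentiable f x.
Proof. by move=> /(_ 1%N)[H _]; exact: H. Qed.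

Lemma smooth_on_derive (p : nat) (W : normedModType R) (U : set 'rV[R]_p)
    (f : 'rV[R]_p -> W) v :
  smooth_on U f -> smooth_on U (fun x => 'D_v f x).
Proof. by move=> sf r; have [_] := sf r.+1; exact. Qed.

Lemma smooth_on_derive_swap (p a b : nat) (U : set 'rV[R]_p)
    (f : 'rV[R]_p -> 'M[R]_(a, b)) (x u v : 'rV[R]_p) :
  open U -> smooth_on U f -> U x ->
  'D_v (fun y => 'D_u f y) x = 'D_u (fun y => 'D_v f y) x.
Proof.
move=> Uo sf Ux.
have near_D w i j : \forall y \near x,
    is_derive y w (fun z => f z i j : R^o) ('D_w f y i j : R^o).
  near=> y; apply: (is_derive_mx f _ y w).2.
  rewrite deriveE; last first.
    by apply: smooth_on_differentiable sf _; near: y; exact: open_nbhs_nbhs.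
  apply: is_derive_diff.
  by apply: smooth_on_differentiable sf _; near: y; exact: open_nbhs_nbhs.
have dD w : differentiable (fun y => 'D_w f y) x.
  by apply: (smooth_on_differentiable _ Ux); exact: smooth_on_derive.
have dDe w i j : differentiable (fun y => 'D_w f y i j : R^o) x.
  apply: (@differentiable_comp _ _ _ _ (fun y => 'D_w f y)
    (fun A : 'M[R]_(a, b) => A i j : R^o)) => //.
  exact: differentiable_coord.
rewrite !derive_mx; [|exact: diff_derivable..].
apply/matrixP => i j; rewrite [LHS]mxE [RHS]mxE.
exact: (derive_swap (near_D u i j) (near_D v i j)).
Unshelve. all: by end_near. Qed.

(** The direction [V y] moves with the point: expanding it over the basis reduces the claim to the
    product rule and to the chain rule for each fixed basis direction. *)
Lemma is_derive_derive (p q : nat) (W : normedModType R) (U : set 'rV[R]_p)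
    (f : 'rV[R]_p -> W) (g V : 'rV[R]_q -> 'rV[R]_p) dg dV (x v : 'rV[R]_q) :
  open U -> smooth_on U f -> U (g x) -> {for x, continuous g} ->
  is_derive x v g dg -> is_derive x v V dV ->
  is_derive x v (fun y => 'D_(V y) f (g y))
    ('D_dg (fun z => 'D_(V x) f z) (g x) + 'D_dV f (g x)).
Proof.
move=> Uo sf Ux gc hg hV.
have DE z w : U z -> 'D_w f z = \sum_k w 0 k *: 'D_(delta_mx 0 k) f z.
  move=> Uz; have df := smooth_on_differentiable sf Uz.
  rewrite deriveE// {1}[w]row_sum_delta linear_sum; apply: eq_bigr => k _.
  by rewrite linearZ deriveE.
have nU : \forall y \near x, U (g y) by apply: gc; exact: open_nbhs_nbhs.
apply: (@near_eq_is_derive _ _ _ (fun y => \sum_k V y 0 k *: 'D_(delta_mx 0 k) f (g y))).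
  by apply: filterS nU => y Uy; rewrite DE.
pose d2 k := 'D_dg (fun z => 'D_(delta_mx 0 k) f z) (g x).
have hk k : is_derive x v (fun y => V y 0 k *: 'D_(delta_mx 0 k) f (g y))
   (dV 0 k *: 'D_(delta_mx 0 k) f (g x) + V x 0 k *: d2 k).
  apply: is_derive_scale; first exact: (is_derive_mx V dV x v).2.
  have dk : differentiable (fun z => 'D_(delta_mx 0 k) f z) (g x).
    by apply: (smooth_on_differentiable _ Ux); exact: smooth_on_derive.
  by rewrite /d2 deriveE//; exact: (is_derive_comp dk hg).
apply: is_derive_eq (is_derive_sumr hk) _.
rewrite big_split /= addrC -DE//; congr (_ + _).
rewrite (@near_eq_derive _ _ _ _
  (fun z => \sum_k V x 0 k *: 'D_(delta_mx 0 k) f z)); last first.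
  by near=> z; apply: DE; near: z; exact: open_nbhs_nbhs.
symmetry; apply: derive_val; apply: is_derive_sumr => k.
have dk : differentiable (fun z => 'D_(delta_mx 0 k) f z) (g x).
  by apply: (smooth_on_differentiable _ Ux); exact: smooth_on_derive.
rewrite /d2 deriveE//; exact: (is_deriveZ (V x 0 k) (is_derive_diff dg dk)).
Unshelve. all: by end_near. Qed.

End Smooth.

(** * Bilinear forms given by matrices *)

Section Inner.
Variable R : realType.
Implicit Types (m p : nat).

Lemma innerDl m (A : 'M[R]_m) u v w : inner A (u + v) w = inner A u w + inner A v w.
Proof. by rewrite /inner !mulmxDl mxE. Qed.

Lemma innerDr m (A : 'M[R]_m) u v w : inner A w (u + v) = inner A w u + inner A w v.
Proof. by rewrite /inner linearD mulmxDr mxE. Qed.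

Lemma innerZl m (A : 'M[R]_m) c u w : inner A (c *: u) w = c * inner A u w.
Proof. by rewrite /inner -!scalemxAl mxE. Qed.

Lemma innerZr m (A : 'M[R]_m) c u w : inner A w (c *: u) = c * inner A w u.
Proof. by rewrite /inner linearZ -scalemxAr mxE. Qed.

Lemma innerNl m (A : 'M[R]_m) u w : inner A (- u) w = - inner A u w.
Proof. by rewrite -scaleN1r innerZl mulN1r. Qed.

Lemma innerNr m (A : 'M[R]_m) u w : inner A w (- u) = - inner A w u.
Proof. by rewrite -scaleN1r innerZr mulN1r. Qed.

Lemma inner0l m (A : 'M[R]_m) w : inner A 0 w = 0.
Proof. by rewrite /inner !mul0mx mxE. Qed.

Lemma inner0r m (A : 'M[R]_m) w : inner A w 0 = 0.
Proof. by rewrite /inner trmx0 mulmx0 mxE. Qed.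

Lemma inner_suml m (A : 'M[R]_m) (I : finType) (f : I -> 'rV[R]_m) w :
  inner A (\sum_i f i) w = \sum_i inner A (f i) w.
Proof. by rewrite /inner !mulmx_suml summxE. Qed.

Lemma innerDm m (A B : 'M[R]_m) u v : inner (A + B) u v = inner A u v + inner B u v.
Proof. by rewrite /inner mulmxDr mulmxDl mxE. Qed.

Lemma innerZm m (A : 'M[R]_m) c u v : inner (c *: A) u v = c * inner A u v.
Proof. by rewrite /inner -scalemxAr -scalemxAl mxE. Qed.

Lemma inner_summ m (I : finType) (A : I -> 'M[R]_m) u v :
  inner (\sum_i A i) u v = \sum_i inner (A i) u v.
Proof. by rewrite /inner mulmx_sumr mulmx_suml summxE. Qed.

Lemma inner_tr m (A : 'M[R]_m) u v : inner A^T u v = inner A v u.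
Proof.
rewrite /inner -[u *m A^T *m v^T]trmxK mxE !trmx_mul !trmxK.
by rewrite mulmxA.
Qed.

Lemma innerE m (A : 'M[R]_m) u v :
  inner A u v = \sum_i \sum_j u 0 i * v 0 j * A i j.
Proof.
rewrite /inner -mulmxA mxE; apply: eq_bigr => i _.
rewrite mxE mulr_sumr; apply: eq_bigr => j _.
by rewrite mxE mulrAC mulrA mulrAC.
Qed.

Lemma inner_mulmx m p (A : 'M[R]_m) (J : 'M[R]_(p, m)) u v :
  inner A (u *m J) (v *m J) = inner (J *m A *m J^T) u v.
Proof. by rewrite /inner trmx_mul !mulmxA. Qed.

Lemma inner_nondeg m (A : 'M[R]_m) u v : A \in unitmx ->
  (forall w, inner A u w = inner A v w) -> u = v.
Proof.
move=> Au H; rewrite -[u](mulmxK Au) -[v](mulmxK Au); congr (_ *m _).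
apply/rowP => j; have := H (delta_mx 0 j).
by rewrite /inner trmx_delta -!colE !mxE.
Qed.

Definition posdef m (A : 'M[R]_m) : Prop :=
  A^T = A /\ forall u, u != 0 -> 0 < inner A u u.

Lemma posdef_unit m (A : 'M[R]_m) : posdef A -> A \in unitmx.
Proof.
move=> [_ Ap]; rewrite unitmxE unitfE; apply/det0P => -[v v0 vA].
by have := Ap _ v0; rewrite /inner vA mul0mx mxE ltxx.
Qed.

Lemma posdef_inner0 m (A : 'M[R]_m) u : posdef A -> inner A u u = 0 -> u = 0.
Proof.
move=> [_ Ap] u0; apply/eqP; apply: contraT => /Ap.
by rewrite u0 ltxx.
Qed.

Lemma innerC m (A : 'M[R]_m) u v : A^T = A -> inner A u v = inner A v u.
Proof. by move=> As; rewrite -inner_tr As. Qed.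

Lemma differentiable_inner (p m : nat) (A : 'rV[R]_p -> 'M[R]_m)
    (f h : 'rV[R]_p -> 'rV[R]_m) x :
  differentiable A x -> differentiable f x -> differentiable h x ->
  differentiable (fun y => inner (A y) (f y) (h y) : R^o) x.
Proof.
move=> dA df dh.
have dc a b (B : 'rV[R]_p -> 'M[R]_(a, b)) i j : differentiable B x ->
    differentiable (fun y => B y i j : R^o) x.
  move=> dB; apply: (@differentiable_comp _ _ _ _ B
    (fun C : 'M[R]_(a, b) => C i j : R^o)) => //.
  exact: differentiable_coord.
rewrite (_ : (fun y => _) =
   \sum_i \sum_j ((fun y => f y 0 i : R^o) * (fun y => h y 0 j : R^o) *
     (fun y => A y i j : R^o))).
  apply: differentiable_sum => i; apply: differentiable_sum => j.
  apply: differentiableM; [apply: differentiableM|]; exact: dc.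
apply: funext => y; rewrite innerE fct_sumE; apply: eq_bigr => i _.
by rewrite fct_sumE; apply: eq_bigr.
Qed.

End Inner.

(** * Derivative of the inverse of a matrix *)

Section Inverse.
Variable R : realType.

Lemma derivable_bigprod (V : normedModType R) (I : Type) (s : seq I)
    (f : I -> V -> R^o) (x v : V) :
  (forall i, derivable (f i) x v) ->
  derivable (fun y => \prod_(i <- s) f i y : R^o) x v.
Proof.
move=> H; elim: s => [|i s IH].
  rewrite (_ : (fun y => _) = cst 1); first exact: derivable_cst.
  by apply: funext => y; rewrite big_nil.
rewrite (_ : (fun y => _) = f i * (fun y => \prod_(j <- s) f j y : R^o)).
  exact: (derivableM (H i) IH).
by apply: funext => y; rewrite big_cons.
Qed.

Lemma derivable_det (V : normedModType R) (n : nat) (A : V -> 'M[R]_n)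
    (x v : V) :
  derivable A x v -> derivable (fun y => \det (A y) : R^o) x v.
Proof.
move=> /derivable_mxP dA.
suff H (s : {perm 'I_n}) : is_derive x v
   (fun y => (-1) ^+ odd_perm s * (\prod_i A y i (s i)) : R^o)
   ('D_v (fun y => (-1) ^+ odd_perm s * (\prod_i A y i (s i)) : R^o) x).
  by have [] := is_derive_sumr H.
apply: derivableP.
have h : derivable (fun y => \prod_i A y i (s i) : R^o) x v.
  by apply: derivable_bigprod => i; exact: dA.
rewrite (_ : (fun y => _) = ((-1) ^+ odd_perm s : R) \*: (fun y => \prod_i A y i (s i) : R^o)).
  exact: derivableZ.
by apply: funext.
Qed.

Lemma derivable_adj (V : normedModType R) (n : nat) (A : V -> 'M[R]_n)
    (x v : V) :
  derivable A x v -> derivable (fun y => \adj (A y)) x v.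
Proof.
move=> dA; apply/derivable_mxP => i j.
rewrite (_ : (fun y => _) = ((-1) ^+ (j + i) : R) \*:
    (fun y => \det (row' j (col' i (A y))) : R^o)); last first.
  by apply: funext => y; rewrite mxE.
apply: derivableZ; apply: derivable_det; apply/derivable_mxP => k l.
rewrite (_ : (fun y => _) = fun y => A y (lift j k) (lift i l)).
  by move/derivable_mxP : dA; apply.
by apply: funext => y; rewrite !mxE.
Qed.

Lemma derivable_near_neq0 (f : R^o -> R^o) :
  derivable f 0 1 -> f 0 != 0 -> \forall y \near (0 : R^o), f y != 0.
Proof.
move=> /derivable1_diffP/differentiable_continuous fc f0.
have fc' : f @ (0 : R^o) --> f 0 by exact: fc.
exact: (cvgr_neq0 _ fc').
Qed.

Lemma derivable_inv0 (f : R^o -> R^o) :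
  derivable f 0 1 -> f 0 != 0 -> derivable (fun y => (f y)^-1 : R^o) 0 1.
Proof. by move=> df f0; exact: derivableV. Qed.

Lemma derivable_invmx0 (n : nat) (A : R^o -> 'M[R]_n) :
  derivable A 0 1 -> A 0 \in unitmx -> derivable (fun y => invmx (A y)) 0 1.
Proof.
move=> dA A0; have dd := derivable_det dA.
have d0 : \det (A 0) != 0 by rewrite -unitfE -unitmxE.
have e : \forall y \near (0 : R^o), (\det (A y))^-1 *: \adj (A y) = invmx (A y).
  apply: filterS (derivable_near_neq0 dd d0) => y dy.
  by rewrite /invmx unitmxE unitfE dy.
apply: (near_eq_derivable e).
have h1 := derivableP (derivable_inv0 dd d0).
have h2 := derivableP (derivable_adj dA).
by have [] := is_derive_scale h1 h2.
Qed.

(** [A] may be discontinuous off the line through [x], so its determinant is known to stay nonzero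
    only along that line; hence the passage to one real variable, where differentiating
    [A *m invmx A = 1] gives the formula. *)
Lemma is_derive_invmx (V : normedModType R) (n : nat) (A : V -> 'M[R]_n) dA
    (x v : V) :
  is_derive x v A dA -> A x \in unitmx ->
  is_derive x v (fun y => invmx (A y)) (- (invmx (A x) *m dA *m invmx (A x))).
Proof.
move=> hA Ax.
have E : x = (0 : R) *: v + x by rewrite scale0r add0r.
rewrite {1}E; apply/is_derive_line.
have hB : is_derive (0 : R^o) (1 : R^o) (fun b : R^o => A (b *: v + x)) dA.
  by apply: (is_derive_line A v x 0 dA).1; rewrite scale0r add0r.
have B0 : A ((0 : R) *: v + x) \in unitmx by rewrite scale0r add0r.
have [dB _] := hB.
have hI := derivableP (derivable_invmx0 dB B0).
set I := (fun b : R^o => invmx (A (b *: v + x))) in hI *.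
apply: (is_derive_eq hI).
have nB : \forall b \near (0 : R^o), A (b *: v + x) \in unitmx.
  apply: filterS (derivable_near_neq0 (derivable_det dB) _).
    by move=> b; rewrite unitmxE unitfE.
  by rewrite -unitfE -unitmxE.
have hp := is_derive_mulmx hB hI.
have h1 : is_derive (0 : R^o) (1 : R^o) (fun b : R^o => A (b *: v + x) *m I b) 0.
  have hc : is_derive (0 : R^o) (1 : R^o) (fun=> 1%:M : 'M[R]_n) 0.
    exact: is_derive_cst.
  apply: near_eq_is_derive hc.
  by apply: filterS nB => b ?; rewrite /I mulmxV.
have : dA *m I 0 + A (0 *: v + x) *m 'D_1 I 0 = 0.
  by have [_ <-] := hp; have [_ <-] := h1.
move=> /eqP; rewrite addrC addr_eq0 => /eqP /(congr1 (mulmx (I 0))).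
by rewrite /I -E mulmxA mulVmx// mul1mx mulmxN mulmxA => ->.
Qed.

End Inverse.

(** * Levi-Civita connection in coordinates *)

Section LocalMetric.
Variable R : realType.

Lemma derive_row_sum (p : nat) (W : normedModType R) (f : 'rV[R]_p -> W)
    (x u : 'rV[R]_p) : differentiable f x ->
  'D_u f x = \sum_i u 0 i *: 'D_(delta_mx 0 i) f x.
Proof.
move=> df; rewrite deriveE// {1}[u]row_sum_delta linear_sum.
by apply: eq_bigr => i _; rewrite linearZ deriveE.
Qed.

Lemma deriveDv (V W : normedModType R) (f : V -> W) (x u v : V) :
  differentiable f x -> 'D_(u + v) f x = 'D_u f x + 'D_v f x.
Proof. by move=> df; rewrite !deriveE// linearD. Qed.

Lemma deriveZv (V W : normedModType R) (f : V -> W) (x u : V) (c : R) :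
  differentiable f x -> 'D_(c *: u) f x = c *: 'D_u f x.
Proof. by move=> df; rewrite !deriveE// linearZ. Qed.

Lemma derive_entry (V : normedModType R) (a b : nat) (f : V -> 'M[R]_(a, b))
    (x v : V) i j : differentiable f x ->
  'D_v (fun y => f y i j : R^o) x = 'D_v f x i j.
Proof.
move=> df; have h := is_derive_diff v df.
by have [_ ->] := (is_derive_mx f _ x v).2 h i j; rewrite deriveE.
Qed.

Lemma inner_delta_l (m : nat) (A : 'M[R]_m) i w :
  inner A (delta_mx 0 i) w = \sum_l A i l * w 0 l.
Proof.
rewrite /inner -rowE mxE; apply: eq_bigr => l _.
by rewrite !mxE.
Qed.

Lemma inner_delta (m : nat) (A : 'M[R]_m) i j :
  inner A (delta_mx 0 i) (delta_mx 0 j) = A i j.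
Proof. by rewrite /inner trmx_delta -rowE -colE !mxE. Qed.

Lemma inner_expand (m : nat) (A : 'M[R]_m) u v :
  inner A u v = \sum_i \sum_j u 0 i * v 0 j * inner A (delta_mx 0 i) (delta_mx 0 j).
Proof.
rewrite innerE; apply: eq_bigr => i _; apply: eq_bigr => j _.
by rewrite inner_delta.
Qed.

Lemma inner_expand_l (m : nat) (A : 'M[R]_m) u v :
  inner A u v = \sum_i u 0 i * inner A (delta_mx 0 i) v.
Proof.
rewrite {1}[u]row_sum_delta inner_suml; apply: eq_bigr => i _.
by rewrite innerZl.
Qed.

Lemma inner_christoffel (m : nat) (G : 'rV[R]_m -> 'M[R]_m) x i j w :
  differentiable G x -> G x \in unitmx ->
  inner (G x) (christoffel G x i j) w =
  2^-1 * (inner ('D_(delta_mx 0 i) G x) (delta_mx 0 j) w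
        + inner ('D_(delta_mx 0 j) G x) (delta_mx 0 i) w
        - inner ('D_w G x) (delta_mx 0 i) (delta_mx 0 j)).
Proof.
move=> dG Gu; rewrite /christoffel {1}/inner mulmxKV// -scalemxAl.
rewrite [LHS]mxE; congr (_ * _); rewrite [LHS]mxE.
have E : inner ('D_w G x) (delta_mx 0 i) (delta_mx 0 j) =
    \sum_l w 0 l * 'D_(delta_mx 0 l) G x i j.
  rewrite (derive_row_sum w dG) inner_delta summxE.
  by apply: eq_bigr => l _; rewrite mxE.
rewrite [X in _ = X + _ - _]inner_delta_l [X in _ = _ + X - _]inner_delta_l.
rewrite [X in _ = _ - X]E -big_split -sumrB /=; apply: eq_bigr => l _.
by rewrite [_^T _ _]mxE [X in X * _]mxE !derive_entry// mulrBl mulrDl [w 0 l * _]mulrC.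
Qed.

(** Koszul formula for constant vector fields: pairing with [G x] cancels the inverse metric inside
    [christoffel]. *)
Lemma inner_Gamma (m : nat) (G : 'rV[R]_m -> 'M[R]_m) x u v w :
  differentiable G x -> G x \in unitmx ->
  inner (G x) (Gamma G x u v) w =
  2^-1 * (inner ('D_u G x) v w + inner ('D_v G x) u w - inner ('D_w G x) u v).
Proof.
move=> dG Gu; rewrite /Gamma inner_suml.
under eq_bigr => i _ do rewrite inner_suml.
under eq_bigr => i _ do under eq_bigr => j _ do
  rewrite innerZl inner_christoffel// mulrCA.
under eq_bigr => i _ do rewrite -mulr_sumr.
rewrite -mulr_sumr; congr (_ * _).
have E1 u' v' : inner ('D_u' G x) v' w = \sum_i \sum_j
    u' 0 i * v' 0 j * inner ('D_(delta_mx 0 i) G x) (delta_mx 0 j) w.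
  rewrite (derive_row_sum u' dG) inner_summ; apply: eq_bigr => i _.
  rewrite innerZm inner_expand_l mulr_sumr; apply: eq_bigr => j _.
  by rewrite mulrA.
have E2 := inner_expand ('D_w G x) u v.
pose t (u' v' w' : 'rV[R]_m) := inner ('D_u' G x) v' w'.
suff aux (a b c : R) :
    a = \sum_i \sum_j u 0 i * v 0 j * t (delta_mx 0 i) (delta_mx 0 j) w ->
    b = \sum_i \sum_j v 0 i * u 0 j * t (delta_mx 0 i) (delta_mx 0 j) w ->
    c = \sum_i \sum_j u 0 i * v 0 j * t w (delta_mx 0 i) (delta_mx 0 j) ->
    \sum_i \sum_j u 0 i * v 0 j * (t (delta_mx 0 i) (delta_mx 0 j) w
      + t (delta_mx 0 j) (delta_mx 0 i) w - t w (delta_mx 0 i) (delta_mx 0 j))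
    = a + b - c.
  exact: (aux _ _ _ (E1 u v) (E1 v u) E2).
move=> -> -> ->; rewrite [X in _ + X - _]exchange_big /=.
rewrite -big_split -sumrB /=; apply: eq_bigr => i _.
rewrite -big_split -sumrB /=; apply: eq_bigr => j _.
by rewrite mulrBr mulrDr [v 0 j * u 0 i]mulrC.
Qed.

Lemma GammaDr (m : nat) (G : 'rV[R]_m -> 'M[R]_m) x u v w :
  Gamma G x w (u + v) = Gamma G x w u + Gamma G x w v.
Proof.
rewrite /Gamma -big_split; apply: eq_bigr => i _; rewrite -big_split.
by apply: eq_bigr => j _; rewrite mxE mulrDr scalerDl.
Qed.

Lemma GammaZr (m : nat) (G : 'rV[R]_m -> 'M[R]_m) x c u w :
  Gamma G x w (c *: u) = c *: Gamma G x w u.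
Proof.
rewrite /Gamma scaler_sumr; apply: eq_bigr => i _; rewrite scaler_sumr.
by apply: eq_bigr => j _; rewrite mxE scalerA mulrCA.
Qed.

Lemma Gamma_0r (m : nat) (G : 'rV[R]_m -> 'M[R]_m) x w : Gamma G x w 0 = 0.
Proof. by have := GammaZr G x 0 0 w; rewrite !scale0r. Qed.

Lemma Gamma_sumr (m : nat) (G : 'rV[R]_m -> 'M[R]_m) x w (I : finType)
    (f : I -> 'rV[R]_m) :
  Gamma G x w (\sum_i f i) = \sum_i Gamma G x w (f i).
Proof.
apply: (big_morph (Gamma G x w)) => [u v|]; first exact: GammaDr.
exact: Gamma_0r.
Qed.

(** No more than differentiability is asked, because the metric of the leaf is given by its pullback
    formula and this much follows from it. *)
Definition local_metric (m : nat) (W : set 'rV[R]_m) (G : 'rV[R]_m -> 'M[R]_m) :=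
  [/\ open W, forall x, W x -> differentiable G x & forall x, W x -> posdef (G x)].

Section LocalMetricTheory.
Variables (m : nat) (W : set 'rV[R]_m) (G : 'rV[R]_m -> 'M[R]_m).
Hypothesis GW : local_metric W G.

Lemma local_metric_diff x : W x -> differentiable G x.
Proof. by move=> Wx; have [_ dG _] := GW; exact: dG. Qed.

Lemma local_metric_unit x : W x -> G x \in unitmx.
Proof. by move=> Wx; have [_ _ H] := GW; exact/posdef_unit/H. Qed.

Lemma local_metricC x u v : W x -> inner (G x) u v = inner (G x) v u.
Proof. by move=> Wx; have [_ _ H] := GW; apply: innerC; have [] := H x Wx. Qed.

Lemma local_metric_nbhs x : W x -> \forall y \near x, W y.
Proof. by move=> Wx; have [Wo _ _] := GW; exact: open_nbhs_nbhs. Qed.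

Lemma derive_metricC x u v w : W x ->
  inner ('D_w G x) u v = inner ('D_w G x) v u.
Proof.
move=> Wx; apply: innerC.
have h := derivableP (@diff_derivable _ _ _ G x w (local_metric_diff Wx)).
have [_ <-] := is_derive_trmx h.
apply: near_eq_derive; apply: filterS (local_metric_nbhs Wx) => y Wy.
by have [_ _ H] := GW; have [] := H y Wy.
Qed.

Lemma local_koszul x u v w : W x ->
  inner (G x) (Gamma G x u v) w =
  2^-1 * (inner ('D_u G x) v w + inner ('D_v G x) u w - inner ('D_w G x) u v).
Proof.
by move=> Wx; apply: inner_Gamma; [exact: local_metric_diff|exact: local_metric_unit].
Qed.

(** Absence of torsion, read off from the Koszul formula, whose right side is symmetric in [u] and
    [v]. *)
Lemma GammaC x u v : W x -> Gamma G x u v = Gamma G x v u.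
Proof.
move=> Wx; apply: (inner_nondeg (local_metric_unit Wx)) => w.
apply: (etrans (local_koszul u v w Wx)); apply: etrans (esym (local_koszul v u w Wx)).
have aux (a b c d : R) : c = d -> 2^-1 * (a + b - c) = 2^-1 * (b + a - d).
  by move=> ->; rewrite [a + b]addrC.
exact: aux (derive_metricC u v w Wx).
Qed.

(** In the sum of the Koszul formulas for [(u, v, w)] and [(u, w, v)] everything cancels except the
    derivative in the direction [u]. *)
Lemma metric_compat x u v w : W x ->
  inner ('D_u G x) v w = inner (G x) (Gamma G x u v) w + inner (G x) v (Gamma G x u w).
Proof.
move=> Wx.
have aux (p q r a b c d : R) : q = r -> p = 2^-1 * (a + b - c) ->
  r = 2^-1 * (d + c - b) -> d = a -> a = p + q by lra.
exact: (aux _ _ _ _ _ _ _ (local_metricC v (Gamma G x u w) Wx)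
  (local_koszul u v w Wx) (local_koszul u w v Wx) (derive_metricC w v u Wx)).
Qed.

End LocalMetricTheory.

End LocalMetric.

(** * Connection of a pullback metric *)

Section IsometricKoszul.
Variable R : realType.

Lemma inner_jacobian (p m : nat) (f : 'rV[R]_p -> 'rV[R]_m) x (A : 'M[R]_m) u v :
  differentiable f x ->
  inner ('J f x *m A *m ('J f x)^T) u v = inner A ('D_u f x) ('D_v f x).
Proof. by move=> df; rewrite !deriveEjacobian// inner_mulmx. Qed.

Lemma is_derive_metric_along (p m : nat) (W : set 'rV[R]_m) (G : 'rV[R]_m -> 'M[R]_m)
    (f V V' : 'rV[R]_p -> 'rV[R]_m) df dV dV' (x u : 'rV[R]_p) :
  local_metric W G -> W (f x) ->
  is_derive x u f df -> is_derive x u V dV -> is_derive x u V' dV' ->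
  is_derive x u (fun y => inner (G (f y)) (V y) (V' y) : R^o)
    (inner ('D_df G (f x)) (V x) (V' x) + inner (G (f x)) dV (V' x)
     + inner (G (f x)) (V x) dV').
Proof.
move=> GW Wfx hf hV hV'.
have dG := local_metric_diff GW Wfx.
have hG := is_derive_comp dG hf.
have := is_derive_inner hG hV hV'; rewrite deriveE//.
Qed.

Lemma derive_pullback (p m : nat) (U : set 'rV[R]_p) (W : set 'rV[R]_m)
    (f : 'rV[R]_p -> 'rV[R]_m) (G : 'rV[R]_m -> 'M[R]_m)
    (H : 'rV[R]_p -> 'M[R]_p) x u v w :
  local_metric W G -> local_metric U H -> smooth_on U f ->
  (forall y, U y -> W (f y)) ->
  (forall y, U y -> H y = 'J f y *m G (f y) *m ('J f y)^T) -> U x ->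
  inner ('D_u H x) v w = inner ('D_('D_u f x) G (f x)) ('D_v f x) ('D_w f x)
    + inner (G (f x)) ('D_u (fun y => 'D_v f y) x) ('D_w f x)
    + inner (G (f x)) ('D_v f x) ('D_u (fun y => 'D_w f y) x).
Proof.
move=> GW HU sf fW HE Ux.
have df y : U y -> differentiable f y by exact: smooth_on_differentiable.
have dd v' : is_derive x u (fun y => 'D_v' f y) ('D_u (fun y => 'D_v' f y) x).
  apply/derivableP/diff_derivable.
  by apply: (smooth_on_differentiable _ Ux); exact: smooth_on_derive.
have hf := derivableP (@diff_derivable _ _ _ f x u (df x Ux)).
have h1 := is_derive_metric_along GW (fW x Ux) hf (dd v) (dd w).
have hH := derivableP (@diff_derivable _ _ _ H x u (local_metric_diff HU Ux)).
have h2 := is_derive_inner hH (is_derive_cst v x u) (is_derive_cst w x u).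
have [_ <-] := h1; apply: etrans (near_eq_derive _ _); last first.
  apply: filterS (local_metric_nbhs HU Ux) => y Uy.
  rewrite -(inner_jacobian _ _ _ (df y Uy)) -(HE y Uy); reflexivity.
have [_ ->] := h2.
by rewrite inner0l inner0r !addr0.
Qed.

(** In the Koszul combination of the three derivatives of the pullback metric, the second
    derivatives of [f] cancel by symmetry, except the one along [u] and [v], which occurs twice. *)
Lemma isometric_koszul (p m : nat) (U : set 'rV[R]_p) (W : set 'rV[R]_m)
    (f : 'rV[R]_p -> 'rV[R]_m) (G : 'rV[R]_m -> 'M[R]_m)
    (H : 'rV[R]_p -> 'M[R]_p) x u v w :
  local_metric W G -> local_metric U H -> smooth_on U f ->
  (forall y, U y -> W (f y)) ->
  (forall y, U y -> H y = 'J f y *m G (f y) *m ('J f y)^T) -> U x ->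
  inner (G (f x)) ('D_u (fun y => 'D_v f y) x
     + Gamma G (f x) ('D_u f x) ('D_v f x)) ('D_w f x)
  = inner (H x) (Gamma H x u v) w.
Proof.
move=> GW HU sf fW HE Ux; have Wfx := fW x Ux.
have [Uo _ _] := HU.
have E a b c := derive_pullback a b c GW HU sf fW HE Ux.
have sw a b : 'D_a (fun y => 'D_b f y) x = 'D_b (fun y => 'D_a f y) x.
  exact: (smooth_on_derive_swap b a Uo sf Ux).
have aux (k D d1 d2 d3 e1 e2 e3 a1 a2 a3 a4 a5 K : R) :
  k = 2^-1 * (d1 + d2 - d3) ->
  d1 = e1 + D + a1 -> d2 = e2 + a2 + a3 -> d3 = e3 + a4 + a5 ->
  a2 = D -> a1 = a4 -> a3 = a5 ->
  K = 2^-1 * (e1 + e2 - e3) -> D + K = k by lra.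
have q1 := congr1 (fun z => inner (G (f x)) z ('D_w f x)) (sw v u).
have q2 := etrans (local_metricC GW ('D_v f x) _ Wfx)
  (congr1 (fun z => inner (G (f x)) z ('D_v f x)) (sw u w)).
have q3 := congr1 (fun z => inner (G (f x)) ('D_u f x) z) (sw v w).
rewrite innerDl.
exact: (aux _ _ _ _ _ _ _ _ _ _ _ _ _ _ (local_koszul HU u v w Ux)
  (E u v w) (E v u w) (E w u v) q1 q2 q3
  (local_koszul GW ('D_u f x) ('D_v f x) ('D_w f x) Wfx)).
Qed.

End IsometricKoszul.

(** * Closed conformal fields and their conformal factor *)

Section Conformal.
Variable R : realType.
Variables (m : nat) (W : set 'rV[R]_m) (G : 'rV[R]_m -> 'M[R]_m).
Variables (xi : 'rV[R]_m -> 'rV[R]_m) (psi : 'rV[R]_m -> R^o).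
Hypothesis GW : local_metric W G.
Hypothesis sG : smooth_on W G.
Hypothesis sxi : smooth_on W xi.
Hypothesis spsi : smooth_on W psi.
Hypothesis conf : forall x, W x -> forall u, covd G id xi x u = psi x *: u.

Lemma derive_conformal x u : W x -> 'D_u xi x = psi x *: u - Gamma G x u (xi x).
Proof.
move=> Wx; rewrite -(conf Wx u) /covd.
have -> : 'd (id : 'rV[R]_m -> 'rV[R]_m) x u = u by rewrite diff_val.
by rewrite addrK.
Qed.

(** The left side is the Lie derivative of the metric along [xi]; metric compatibility and the
    symmetry of [Gamma] cancel all connection terms. *)
Lemma lie_metric x u v : W x ->
  inner ('D_(xi x) G x) u v + inner (G x) ('D_u xi x) v + inner (G x) u ('D_v xi x)
  = 2 * psi x * inner (G x) u v.
Proof.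
move=> Wx; rewrite (derive_conformal u Wx) (derive_conformal v Wx).
rewrite innerDl innerDr innerNl innerNr innerZl innerZr.
have aux (a b c b' c' p q : R) : a = b + c -> b = b' -> c = c' ->
  a + (p * q - b') + (p * q - c') = 2 * p * q.
  by move=> -> -> ->; ring.
apply: (aux _ _ _ _ _ _ _ (metric_compat GW (xi x) u v Wx)).
  by rewrite (GammaC GW (xi x) u Wx).
by rewrite (GammaC GW (xi x) v Wx).
Qed.

Lemma derive_xi_norm x u : W x ->
  is_derive x u (fun y => inner (G y) (xi y) (xi y) : R^o)
    (2 * psi x * inner (G x) u (xi x)).
Proof.
move=> Wx; have hxi := derivableP (@diff_derivable _ _ _ xi x u (smooth_on_differentiable sxi Wx)).
have := is_derive_metric_along GW Wx (is_derive_id x u) hxi hxi.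
move=> /is_derive_eq; apply.
rewrite (metric_compat GW u (xi x) (xi x) Wx) (derive_conformal u Wx).
rewrite innerDl innerDr innerNl innerNr innerZl innerZr.
rewrite (local_metricC GW (xi x) u Wx).
ring.
Qed.

(* The differential of |xi|^2 is 2 psi <xi, .>, so the symmetry of the Hessian of
   |xi|^2 makes d psi proportional to <xi, .>. *)
Lemma derive_psi x w : W x -> xi x != 0 -> inner (G x) w (xi x) = 0 ->
  'D_w psi x = 0.
Proof.
move=> Wx xi0 w0.
pose fu u y := 2 * psi y * inner (G y) u (xi y) : R^o.
have hfu u : \forall y \near x, is_derive y u (fun y => inner (G y) (xi y) (xi y) : R^o) (fu u y).
  by apply: filterS (local_metric_nbhs GW Wx) => y Wy; exact: derive_xi_norm.
have dG := local_metric_diff GW Wx.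
have dxi := smooth_on_differentiable sxi Wx.
have dpsi := smooth_on_differentiable spsi Wx.
have dfu u : differentiable (fu u) x.
  have d1 : differentiable (2 \*: psi) x by exact: differentiableZ.
  have d2 : differentiable (cst u : 'rV[R]_m -> 'rV[R]_m) x by exact: differentiable_cst.
  exact: (differentiableM d1 (differentiable_inner dG d2 dxi)).
have dfE u v : 'D_v (fu u) x = 2 * 'D_v psi x * inner (G x) u (xi x)
   + 2 * psi x * (inner (G x) (Gamma G x v u) (xi x) + psi x * inner (G x) u v).
  have h0 := is_deriveZ (2 : R) (derivableP (@diff_derivable _ _ _ psi x v dpsi)).
  have h1 := derivableP (@diff_derivable _ _ _ xi x v dxi).
  have h2 := is_derive_metric_along GW Wx (is_derive_id x v) (is_derive_cst u x v) h1.
  have [_] := is_derive_scale h0 h2; rewrite -/(fu u) => E; apply: (etrans E).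
  rewrite inner0l addr0 (metric_compat GW v u (xi x) Wx) (derive_conformal v Wx).
  rewrite innerDr innerNr innerZr.
  have aux (c d p a b q : R) : c * d + p * (a + b + (q - b)) = c * d + p * (a + q).
    by ring.
  exact: aux.
(* The vector [xi x] serves as a constant direction. The terms without a derivative of [psi] agree
   on both sides, and the derivative of [psi] along [xi x] is multiplied by
   [inner (G x) w (xi x) = 0]. *)
have := derive_swap (hfu (xi x)) (hfu w) (dfu (xi x)) (dfu w).
rewrite !dfE (GammaC GW (xi x) w Wx) (local_metricC GW (xi x) w Wx) w0.
have aux (p r s t : R) : r != 0 -> 2 * p * r + s = 2 * t * 0 + s -> p = 0.
  move=> r0; rewrite mulr0 => /addIr /eqP; rewrite -mulrA mulf_eq0 pnatr_eq0 /=.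
  by rewrite mulf_eq0 (negbTE r0) orbF => /eqP.
have r0 : inner (G x) (xi x) (xi x) != 0.
  have [_ _ H] := GW; apply/eqP => r0; move/eqP: xi0; apply.
  exact: (posdef_inner0 (H x Wx) r0).
exact: (aux _ _ _ _ r0).
Qed.

(** Needed at three triples [(p, u, v)], whose Koszul combination carries the second derivatives of
    [xi] and of the metric that appear when the second fundamental form moves along the flow. *)
Lemma lie_metric_derive x p u v : W x ->
  inner ('D_p (fun z => 'D_(xi x) G z) x) u v + inner ('D_('D_p xi x) G x) u v
  + inner ('D_p G x) ('D_u xi x) v + inner (G x) ('D_p (fun z => 'D_u xi z) x) v
  + inner ('D_p G x) u ('D_v xi x) + inner (G x) u ('D_p (fun z => 'D_v xi z) x)
  = 2 * 'D_p psi x * inner (G x) u v + 2 * psi x * inner ('D_p G x) u v.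
Proof.
move=> Wx; have [Wo _ _] := GW.
have dxi := smooth_on_differentiable sxi Wx.
have dpsi := smooth_on_differentiable spsi Wx.
have hid := is_derive_id x p.
have hxi := derivableP (@diff_derivable _ _ _ xi x p dxi).
have hx1 q := derivableP (@diff_derivable _ _ _ (fun z => 'D_q xi z) x p
  (smooth_on_differentiable (smooth_on_derive q sxi) Wx)).
have hc q := is_derive_cst (q : 'rV[R]_m) x p.
have h1 := is_derive_inner (is_derive_derive (g := id) Wo sG Wx (@cvg_id _ _) hid hxi)
  (hc u) (hc v).
have h2 := is_derive_metric_along GW Wx hid (hx1 u) (hc v).
have h3 := is_derive_metric_along GW Wx hid (hc u) (hx1 v).
have h4 := is_derive_metric_along GW Wx hid (hc u) (hc v).
have h0 := is_deriveZ (2 : R) (derivableP (@diff_derivable _ _ _ psi x p dpsi)).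
have [_ hl] := is_deriveD (is_deriveD h1 h2) h3.
have [_ hr] := is_derive_scale h0 h4.
have : \forall y \near x,
   inner ('D_(xi y) G y) u v + inner (G y) ('D_u xi y) v + inner (G y) u ('D_v xi y)
   = 2 * psi y * inner (G y) u v.
  by apply: filterS (local_metric_nbhs GW Wx) => y Wy; exact: lie_metric.
move=> /(@near_eq_derive _ _ _ (fun y => inner ('D_(xi y) G y) u v
   + inner (G y) ('D_u xi y) v + inner (G y) u ('D_v xi y) : R^o)
   (fun y => 2 * psi y * inner (G y) u v : R^o) x p) E.
have aux (a a1 a2 z1 z2 b c z3 d z4 e q i t f z5 z6 : R) :
    a + z1 + z2 + (b + c + z3) + (d + z4 + e) = q * i + t * (f + z5 + z6) ->
    a = a1 + a2 -> z1 = 0 -> z2 = 0 -> z3 = 0 -> z4 = 0 -> z5 = 0 -> z6 = 0 ->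
    a1 + a2 + b + c + d + e = q * i + t * f.
  move=> H a12 z10 z20 z30 z40 z50 z60; move: H.
  by rewrite a12 z10 z20 z30 z40 z50 z60 !addr0 !addrA.
exact: (aux _ _ _ _ _ _ _ _ _ _ _ _ _ _ _ _ _ (etrans (etrans (esym hl) E) hr)
  (innerDm _ _ _ _) (inner0l _ _) (inner0r _ _) (inner0r _ _) (inner0l _ _)
  (inner0l _ _) (inner0r _ _)).
Qed.

End Conformal.

(** * Derivability of the Christoffel symbols along a map *)

Section CurvesOfMetric.
Variable R : realType.

Lemma derivable_christoffel_along (p m : nat) (W : set 'rV[R]_m)
    (G : 'rV[R]_m -> 'M[R]_m) (f : 'rV[R]_p -> 'rV[R]_m) x u i j :
  local_metric W G -> smooth_on W G -> W (f x) -> {for x, continuous f} -> derivable f x u ->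
  derivable (fun y => christoffel G (f y) i j) x u.
Proof.
move=> GW sG Wfx fc hf; have [Wo _ _] := GW.
have hG : derivable (fun y => G (f y)) x u.
  by have [] := is_derive_comp (local_metric_diff GW Wfx) (derivableP hf).
have hDG q k l : derivable (fun y => 'D_q G (f y) k l : R^o) x u.
  have d1 := smooth_on_differentiable (smooth_on_derive q sG) Wfx.
  by have [H _] := is_derive_comp d1 (derivableP hf); move/derivable_mxP : H; apply.
have nW : \forall y \near x, W (f y) by apply: fc; exact: open_nbhs_nbhs.
(* The derivative of an entry is the entry of the derivative where [G] is differentiable, so
   [christoffel] can be replaced by [r] near [x]. *)
pose r y := 2^-1 *: \row_l ('D_(delta_mx 0 i) G (f y) j l
  + 'D_(delta_mx 0 j) G (f y) i l - 'D_(delta_mx 0 l) G (f y) i j).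
apply: (@near_eq_derivable _ _ _ (fun y => r y *m invmx (G (f y)))).
  apply: filterS nW => y Wy; have dG := local_metric_diff GW Wy.
  rewrite /r /christoffel; congr (_ *: _ *m _); apply/rowP => l.
  by rewrite [LHS]mxE [RHS]mxE !(derive_entry _ _ _ dG).
have hr : derivable r x u.
  apply: derivableZ; apply/derivable_mxP => a l.
  rewrite (_ : (fun y => _) = (fun y => 'D_(delta_mx 0 i) G (f y) j l
    + 'D_(delta_mx 0 j) G (f y) i l - 'D_(delta_mx 0 l) G (f y) i j : R^o)); last first.
    by apply: funext => y; rewrite mxE.
  exact: (derivableB (derivableD (hDG _ _ _) (hDG _ _ _)) (hDG _ _ _)).
have hI := is_derive_invmx (derivableP hG) (local_metric_unit GW Wfx).
by have [] := is_derive_mulmx (derivableP hr) hI.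
Qed.

Lemma derivable_Gamma_along (p m : nat) (W : set 'rV[R]_m)
    (G : 'rV[R]_m -> 'M[R]_m) (f V V' : 'rV[R]_p -> 'rV[R]_m) x u :
  local_metric W G -> smooth_on W G -> W (f x) -> {for x, continuous f} -> derivable f x u ->
  derivable V x u -> derivable V' x u ->
  derivable (fun y => Gamma G (f y) (V y) (V' y)) x u.
Proof.
move=> GW sG Wfx fc hf hV hV'.
have hc i j := derivableP (@derivable_christoffel_along p m W G f x u i j GW sG Wfx fc hf).
have he (V0 : 'rV[R]_p -> 'rV[R]_m) i : derivable V0 x u ->
    is_derive x u (fun y => V0 y 0 i : R^o) ('D_u (fun y => V0 y 0 i : R^o) x).
  by move=> /derivable_mxP h; exact/derivableP/h.
have h i j := is_derive_scale (is_derive_scale (he V i hV) (he V' j hV')) (hc i j).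
have hs i := is_derive_sumr (h i).
by have [] := is_derive_sumr hs.
Qed.

End CurvesOfMetric.

(** * Second covariant derivatives along the flow *)

Section ConformalFlow.
Variable R : realType.
Variables (m p : nat) (W : set 'rV[R]_m) (G : 'rV[R]_m -> 'M[R]_m).
Variables (xi : 'rV[R]_m -> 'rV[R]_m) (psi : 'rV[R]_m -> R^o).
Variables (U : set 'rV[R]_p) (F : 'rV[R]_p -> 'rV[R]_m) (e : 'rV[R]_p).
Hypothesis GW : local_metric W G.
Hypothesis sG : smooth_on W G.
Hypothesis sxi : smooth_on W xi.
Hypothesis spsi : smooth_on W psi.
Hypothesis conf : forall x, W x -> forall u, covd G id xi x u = psi x *: u.
Hypothesis xi_neq0 : forall x, W x -> xi x != 0.
Hypothesis Uo : open U.
Hypothesis sF : smooth_on U F.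
Hypothesis FW : forall y, U y -> W (F y).
Hypothesis Fe : forall y, U y -> 'D_e F y = xi (F y).

(* nabla_a (d_b F), along F; its normal part is the second fundamental form. *)
Definition second_cov a b (y : 'rV[R]_p) : 'rV[R]_m :=
  'D_a (fun z => 'D_b F z) y + Gamma G (F y) ('D_a F y) ('D_b F y).

(** The covariant derivative along [e], with the velocity already written as [xi (F x)]. *)
Definition flow_covd (V : 'rV[R]_p -> 'rV[R]_m) x : 'rV[R]_m :=
  'D_e V x + Gamma G (F x) (xi (F x)) (V x).

Let nearU x : U x -> \forall y \near x, U y.
Proof. by move=> Ux; exact: open_nbhs_nbhs. Qed.

Let diffF x : U x -> differentiable F x.
Proof. by move=> Ux; exact: smooth_on_differentiable sF Ux. Qed.

Let is_derive_F x a : U x -> is_derive x a F ('D_a F x).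
Proof. by move=> Ux; exact/derivableP/diff_derivable/diffF. Qed.

Let is_derive_DF x a b : U x ->
  is_derive x a (fun y => 'D_b F y) ('D_a (fun y => 'D_b F y) x).
Proof.
move=> Ux; apply/derivableP/diff_derivable.
exact: (smooth_on_differentiable (smooth_on_derive b sF) Ux).
Qed.

Lemma derive_flow a x : U x ->
  'D_e (fun y => 'D_a F y) x = 'D_('D_a F x) xi (F x).
Proof.
move=> Ux; have dxi := smooth_on_differentiable sxi (FW Ux).
rewrite (smooth_on_derive_swap a e Uo sF Ux).
have [_ E] := is_derive_comp dxi (is_derive_F a Ux).
have D : 'D_('D_a F x) xi (F x) = 'd xi (F x) ('D_a F x) by rewrite deriveE.
rewrite D -E.
by apply: near_eq_derive; apply: filterS (nearU Ux) => y; exact: Fe.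
Qed.

Lemma derive2_flow a b x : U x ->
  'D_e (fun y => 'D_a (fun z => 'D_b F z) y) x =
  'D_('D_a F x) (fun z => 'D_('D_b F x) xi z) (F x)
  + 'D_('D_a (fun z => 'D_b F z) x) xi (F x).
Proof.
move=> Ux; have [Wo _ _] := GW.
rewrite (smooth_on_derive_swap a e Uo (smooth_on_derive b sF) Ux).
have Fc : {for x, continuous F} by apply: differentiable_continuous; exact: diffF.
have [_ E] := is_derive_derive Wo sxi (FW Ux) Fc (is_derive_F a Ux) (is_derive_DF a b Ux).
rewrite -E; apply: near_eq_derive.
by apply: filterS (nearU Ux) => y; exact: derive_flow.
Qed.

Lemma derivable_second_cov a b x u : U x -> derivable (second_cov a b) x u.
Proof.
move=> Ux.
have d1 : derivable (fun y => 'D_a (fun z => 'D_b F z) y) x u.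
  apply: diff_derivable.
  exact: (smooth_on_differentiable (smooth_on_derive a (smooth_on_derive b sF)) Ux).
have Fc : {for x, continuous F} by apply: differentiable_continuous; exact: diffF.
have [dF _] := is_derive_F u Ux.
have [dA _] := is_derive_DF u a Ux.
have [dB _] := is_derive_DF u b Ux.
exact: (derivableD d1 (derivable_Gamma_along GW sG (FW Ux) Fc dF dA dB)).
Qed.

(** By the symmetry of the connection, this is the covariant derivative of [xi] in the direction
    ['D_a F x]. *)
Lemma flow_covd_DF a x : U x ->
  flow_covd (fun y => 'D_a F y) x = psi (F x) *: 'D_a F x.
Proof.
move=> Ux; rewrite /flow_covd (derive_flow a Ux) (derive_conformal conf _ (FW Ux)).
by rewrite (GammaC GW (xi (F x)) ('D_a F x) (FW Ux)) subrK.
Qed.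

(* <nabla_e nabla_a F_b, w> is obtained without the curvature tensor: subtract
   from the e-derivative of <nabla_a F_b, w>, expanded by the Koszul formula,
   the Koszul combination of the first derivatives of L_xi g = 2 psi g. *)
Lemma flow_covd_second_cov a b x w : U x ->
  inner (G (F x)) (flow_covd (second_cov a b) x) w =
  psi (F x) * inner (G (F x)) (second_cov a b x) w
  + 'D_('D_a F x) psi (F x) * inner (G (F x)) ('D_b F x) w
  + 'D_('D_b F x) psi (F x) * inner (G (F x)) ('D_a F x) w
  - 'D_w psi (F x) * inner (G (F x)) ('D_a F x) ('D_b F x).
Proof.
move=> Ux; have [Wo _ _] := GW; have Wz := FW Ux.
have Fc : {for x, continuous F} by apply: differentiable_continuous; exact: diffF.
have hF : is_derive x e F (xi (F x)).
  by apply: (is_derive_eq (is_derive_F e Ux)); exact: Fe.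
have hA := is_derive_eq (is_derive_DF e a Ux) (derive_flow a Ux).
have hB := is_derive_eq (is_derive_DF e b Ux) (derive_flow b Ux).
have hN : is_derive x e (fun y => 'D_a (fun z => 'D_b F z) y)
    ('D_('D_a F x) (fun z => 'D_('D_b F x) xi z) (F x)
     + 'D_('D_a (fun z => 'D_b F z) x) xi (F x)).
  apply: is_derive_eq (derive2_flow a b Ux).
  apply/derivableP/diff_derivable.
  exact: (smooth_on_differentiable (smooth_on_derive a (smooth_on_derive b sF)) Ux).
have hw := is_derive_cst (w : 'rV[R]_m) x e.
have hS := derivableP (@derivable_second_cov a b x e Ux).
have [_ e1] := is_derive_metric_along GW Wz hF hS hw.
have E1 := is_derive_metric_along GW Wz hF hN hw.
have E2 := is_derive_inner (is_derive_derive Wo sG Wz Fc hF hA) hB hw.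
have E3 := is_derive_inner (is_derive_derive Wo sG Wz Fc hF hB) hA hw.
have dGw := smooth_on_differentiable (smooth_on_derive w sG) Wz.
have hGw := is_derive_comp dGw hF.
have E4 := is_derive_inner hGw hA hB.
have [_ e2] := is_deriveD E1 (is_deriveZ (2^-1 : R) (is_deriveB (is_deriveD E2 E3) E4)).
pose z := F x; pose A := 'D_a F x; pose B := 'D_b F x.
pose N := 'D_a (fun y => 'D_b F y) x; pose S := second_cov a b x.
pose g1 q u v := inner ('D_q G z) u v.
pose g2 q r u v := inner ('D_q (fun y => 'D_r G y) z) u v.
pose i u v := inner (G z) u v.
pose x1 u := 'D_u xi z.
pose x2 q u := 'D_q (fun y => 'D_u xi y) z.
pose dS := 'D_e (second_cov a b) x.
pose K u v w := 2^-1 * (g1 u v w + g1 v u w - g1 w u v).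
pose a2 := inner ('D_(xi z) (fun y => 'D_A G y) z + 'D_(x1 A) G z) B w.
pose a3 := inner ('D_(xi z) (fun y => 'D_B G y) z + 'D_(x1 B) G z) A w.
pose a4 := inner ('d (fun y => 'D_w G y) z (xi z)) A B.
(* The derivative along [e] of the pairing of [second_cov a b] with the constant [w], computed
   directly on the left, and on the right after the Koszul formula has removed [Gamma]. *)
have f12 : g1 (xi z) S w + i dS w + i S 0 =
    g1 (xi z) N w + i (x2 A B + x1 N) w + i N 0
    + 2^-1 * (a2
        + g1 A (x1 B) w + g1 A B 0
        + (a3
        + g1 B (x1 A) w + g1 B A 0)
      - (a4 + g1 w (x1 A) B + g1 w A (x1 B))).
  apply: (etrans (esym e1)); apply: (etrans _ e2).
  apply: near_eq_derive; apply: filterS (nearU Ux) => y Uy.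
  apply: (etrans (innerDl _ _ _ _)).
  exact (congr2 +%R (erefl _) (local_koszul GW ('D_a F y) ('D_b F y) w (FW Uy))).
have sG' q r : 'D_q (fun y => 'D_r G y) z = 'D_r (fun y => 'D_q G y) z.
  exact: smooth_on_derive_swap r q Wo sG Wz.
have sx q r : x2 q r = x2 r q by exact: smooth_on_derive_swap r q Wo sxi Wz.
have q1 : a2
    = g2 A (xi z) B w + g1 (x1 A) B w.
  apply: (etrans (innerDm _ _ _ _)).
  exact (congr1 (fun M => inner M B w + g1 (x1 A) B w) (sG' (xi z) A)).

have q2 : a3
    = g2 B (xi z) A w + g1 (x1 B) A w.
  apply: (etrans (innerDm _ _ _ _)).
  exact (congr1 (fun M => inner M A w + g1 (x1 B) A w) (sG' (xi z) B)).

have q3 : a4 = g2 w (xi z) A B.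
  have D : 'd (fun y => 'D_w G y) z (xi z) = 'D_(xi z) (fun y => 'D_w G y) z.
    by rewrite deriveE.
  exact (congr1 (fun M => inner M A B) (etrans D (sG' (xi z) w))).

have q4 : i (x2 A B + x1 N) w = i (x2 A B) w + i (x1 N) w by exact: innerDl.
have q5 : i (x2 w A) B = i B (x2 A w).
  exact (etrans (local_metricC GW (x2 w A) B Wz) (congr1 (i B) (sx w A))).
have q6 : i A (x2 w B) = i A (x2 B w) by exact (congr1 (i A) (sx w B)).
have q7 : i (x2 B A) w = i (x2 A B) w by exact (congr1 (fun M => i M w) (sx B A)).
have z1 u : i u 0 = 0 by exact: inner0r.
have z2 q u : g1 q u 0 = 0 by exact: inner0r.
have k1 v : i S v = i N v + K A B v.
  apply: (etrans (innerDl _ _ _ _)).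
  exact (congr2 +%R (erefl _) (local_koszul GW A B v Wz)).
have c1 : g1 (xi z) S w = i (Gamma G z (xi z) S) w + i S (Gamma G z (xi z) w).
  exact (metric_compat GW (xi z) S w Wz).
have c2 : i S (Gamma G z (xi z) w) = psi z * i S w - i S (x1 w).
  have E : Gamma G z (xi z) w = psi z *: w - x1 w.
    rewrite /x1 (derive_conformal conf w Wz) (GammaC GW (xi z) w Wz).
    by rewrite opprB addrC subrK.
  apply: (etrans (congr1 (i S) E)); apply: (etrans (innerDr _ _ _ _)).
  exact (congr2 +%R (innerZr _ _ _ _) (innerNr _ _ _)).
have goalE : inner (G (F x)) (flow_covd (second_cov a b) x) w =
    i dS w + i (Gamma G z (xi z) S) w by exact: innerDl.
pose P : R := psi z; pose dP q : R := 'D_q psi z.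
have l0 : g1 (xi z) N w + i (x1 N) w + i N (x1 w) = 2 * P * i N w.
  exact (lie_metric GW conf N w Wz).
have lie q u v : g2 q (xi z) u v + g1 (x1 q) u v + g1 q (x1 u) v + i (x2 q u) v
    + g1 q u (x1 v) + i u (x2 q v) = 2 * dP q * i u v + 2 * P * g1 q u v.
  exact (lie_metric_derive GW sG sxi spsi conf q u v Wz).
(* In half of [l1 + l2 - l3] the second derivatives of [xi] reduce to [x2 A B], which cancels the
   one in [f12]; the terms with [x1 w] rebuild the pairing of [S] with [x1 w] through [k2]. *)
have {lie}[l1 l2 l3] := And3 (lie A B w) (lie B A w) (lie w A B).
apply: (etrans goalE).
suff : i dS w + i (Gamma G z (xi z) S) w =
  P * i S w + dP A * i B w + dP B * i A w - dP w * i A B by [].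
have k2 : i S (x1 w) = i N (x1 w)
  + 2^-1 * (g1 A B (x1 w) + g1 B A (x1 w) - g1 (x1 w) A B) := k1 (x1 w).
have k3 : i S w = i N w + 2^-1 * (g1 A B w + g1 B A w - g1 w A B) := k1 w.
(* The final relation is linear except for products with [P], which [lra] treats as atoms; hence
   this multiple of [k3]. *)
have k4 := congr1 ( *%R P) k3.
have {z1}[z1 z1'] := conj (z1 S) (z1 N).
have {z2}[z2 z2'] := conj (z2 A B) (z2 B A).
have c2' : i S (Gamma G z (xi z) w) = P * i S w - i S (x1 w) := c2.
pose t1 := i S (Gamma G z (xi z) w); pose t2 := i (Gamma G z (xi z) S) w.
have c1' : g1 (xi z) S w = t2 + t1 := c1.
have c2'' : t1 = P * i S w - i S (x1 w) := c2'.
suff : i dS w + t2 = P * i S w + dP A * i B w + dP B * i A w - dP w * i A B by [].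
clear -f12 c1' c2'' l0 l1 l2 l3 k2 k3 k4 z1 z1' z2 z2' q1 q2 q3 q4 q5 q6 q7.
clearbody a2 a3 a4 t1 t2 g1 g2 i x1 x2 P dP dS S N A B z.
lra.
Qed.

End ConformalFlow.

(** * Orthogonal projection in matrix form *)

Section NormalProjection.
Variable R : realType.
Variables (p m : nat) (A : 'M[R]_m) (J : 'M[R]_(p, m)).

(** Removes the [A]-orthogonal projection of [w] on the row space of [J], whose Gram matrix is
    [J *m A *m J^T]. *)
Definition nproj (w : 'rV[R]_m) : 'rV[R]_m :=
  w - w *m A *m J^T *m invmx (J *m A *m J^T) *m J.

Hypothesis Hu : J *m A *m J^T \in unitmx.

Lemma nproj_orth w c : inner A (nproj w) (c *m J) = 0.
Proof.
rewrite /inner /nproj trmx_mul !mulmxBl [X in _ - X](_ : _ = w *m A *m (J^T *m c^T)).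
  by rewrite subrr mxE.
set Y := w *m A *m J^T *m _; rewrite !mulmxA; congr (_ *m _).
by rewrite -(mulmxA Y) -(mulmxA Y) mulmxKV.
Qed.

Lemma nproj_row c : nproj (c *m J) = 0.
Proof.
rewrite /nproj [X in _ - X](_ : _ = c *m J) ?subrr//.
by rewrite -[c *m J *m A]mulmxA -[c *m _ *m J^T]mulmxA mulmxK.
Qed.

Lemma nproj_eq0 w : nproj w = 0 <-> exists c, w = c *m J.
Proof.
split=> [/eqP|[c ->]]; last exact: nproj_row.
by rewrite subr_eq0 => /eqP E; exists (w *m A *m J^T *m invmx (J *m A *m J^T)).
Qed.

Lemma inner_nproj w v : (forall c, inner A (c *m J) v = 0) ->
  inner A (nproj w) v = inner A w v.
Proof. by move=> H; rewrite /nproj innerDl innerNl H subr0. Qed.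

Lemma nprojE w : nproj w = w - \sum_i \sum_j
  (invmx (J *m A *m J^T) i j * inner A w (row i J)) *: row j J.
Proof.
rewrite /nproj; congr (_ - _).
rewrite [LHS]mulmx_sum_row exchange_big /=; apply: eq_bigr => j _.
rewrite -scaler_suml; congr (_ *: _); rewrite mxE; apply: eq_bigr => i _.
rewrite mulrC; congr (_ * _).
rewrite /inner [LHS]mxE [RHS]mxE; apply: eq_bigr => k _.
by congr (_ * _); rewrite !mxE.
Qed.

End NormalProjection.

(** * Mean curvature as the normal part of a trace *)

Section MeanCurvature.
Variable R : realType.
Variables (m p : nat) (W : set 'rV[R]_m) (G : 'rV[R]_m -> 'M[R]_m).
Variables (U : set 'rV[R]_p) (F : 'rV[R]_p -> 'rV[R]_m) (H : 'rV[R]_p -> 'M[R]_p).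
Hypothesis GW : local_metric W G.
Hypothesis Uo : open U.
Hypothesis sF : smooth_on U F.
Hypothesis FW : forall y, U y -> W (F y).
Hypothesis HE : forall y, U y -> H y = 'J F y *m G (F y) *m ('J F y)^T.
Hypothesis Hu : forall y, U y -> H y \in unitmx.

Lemma jacobian_row y i : U y -> row i ('J F y) = 'D_(delta_mx 0 i) F y.
Proof.
by move=> Uy; rewrite deriveEjacobian ?rowE//; exact: smooth_on_differentiable sF Uy.
Qed.

Lemma diff_basis y i : 'd F y (basis_vec R i) = row i ('J F y).
Proof. by rewrite /jacobian rowE mul_rV_lin1. Qed.

Lemma normal_part_nproj y w : U y ->
  normal_part G F H y w = nproj (G (F y)) ('J F y) w.
Proof.
move=> Uy; rewrite /normal_part nprojE -HE//; congr (_ - _).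
by apply: eq_bigr => i _; apply: eq_bigr => j _; rewrite !diff_basis.
Qed.

(** The trace is taken before projecting; by linearity of the projection the order does not
    matter. *)
Definition trace_second (y : 'rV[R]_p) : 'rV[R]_m :=
  \sum_i \sum_j invmx (H y) i j *: second_cov G F (delta_mx 0 i) (delta_mx 0 j) y.

Lemma covd_diff y a b : U y ->
  covd G F (fun z => 'd F z b) y a = second_cov G F a b y.
Proof.
have dE v z : U z -> 'd F z v = 'D_v F z.
  by move=> Uz; rewrite deriveE//; exact: smooth_on_differentiable sF Uz.
move=> Uy; have h : 'D_a (fun z => 'd F z b) y = 'D_a (fun z => 'D_b F z) y.
  apply: near_eq_derive; have : \forall z \near y, U z by exact: open_nbhs_nbhs.
  by apply: filterS => z; exact: dE.
exact (congr2 +%R h (congr2 (Gamma G (F y)) (dE a y Uy) (dE b y Uy))).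
Qed.

Lemma nproj_sum (A : 'M[R]_m) (J : 'M[R]_(p, m)) (I : finType) (f : I -> 'rV[R]_m) :
  nproj A J (\sum_i f i) = \sum_i nproj A J (f i).
Proof.
by rewrite /nproj !mulmx_suml sumrB.
Qed.

Lemma nprojZ (A : 'M[R]_m) (J : 'M[R]_(p, m)) c w :
  nproj A J (c *: w) = c *: nproj A J w.
Proof. by rewrite /nproj -!scalemxAl scalerBr. Qed.

Lemma mean_curvE y : U y ->
  mean_curv G F H y = p%:R^-1 *: nproj (G (F y)) ('J F y) (trace_second y).
Proof.
move=> Uy; rewrite /mean_curv; congr (_ *: _).
rewrite nproj_sum; apply: eq_bigr => i _; rewrite nproj_sum; apply: eq_bigr => j _.
rewrite nprojZ; congr (_ *: _); apply: (etrans (normal_part_nproj _ Uy)).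
exact (congr1 (nproj (G (F y)) ('J F y)) (covd_diff _ _ Uy)).
Qed.

Lemma mean_curv_eq0 y : U y ->
  mean_curv G F H y = 0 <-> exists c, trace_second y = c *m 'J F y.
Proof.
move=> Uy; have Hy : 'J F y *m G (F y) *m ('J F y)^T \in unitmx.
  by rewrite -HE//; exact: Hu.
rewrite -(nproj_eq0 Hy) mean_curvE//; split=> [/eqP|->]; last by rewrite scaler0.
(* For [p = 0] the factor [p%:R^-1] is 0 and carries no information, but then the trace is an empty
   sum. *)
case: (posnP p) => [p0|p0].
  move=> _; rewrite /trace_second; move: (p0) => E.
  rewrite big1 ?nproj_eq0//; last by move=> i; have := ltn_ord i; rewrite {2}p0.
  by exists 0; rewrite mul0mx.
by rewrite scaler_eq0 invr_eq0 pnatr_eq0 eqn0Ngt p0 /= => /eqP.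
Qed.

Lemma mean_curv_orth y c : U y ->
  inner (G (F y)) (mean_curv G F H y) (c *m 'J F y) = 0.
Proof.
move=> Uy; rewrite mean_curvE// innerZl nproj_orth ?mulr0// -HE//.
exact: Hu.
Qed.

Lemma mean_curv_norm y : U y ->
  inner (G (F y)) (mean_curv G F H y) (mean_curv G F H y) =
  p%:R^-1 * inner (G (F y)) (trace_second y) (mean_curv G F H y).
Proof.
move=> Uy; rewrite {1}mean_curvE// innerZl; congr (_ * _).
apply: inner_nproj.
by move=> c; rewrite (local_metricC GW _ _ (FW Uy)) mean_curv_orth.
Qed.

End MeanCurvature.

(** * Evolution of the mean curvature along the flow *)

Section MeanCurvatureFlow.
Variable R : realType.
Variables (m p : nat) (W : set 'rV[R]_m) (G : 'rV[R]_m -> 'M[R]_m).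
Variables (xi : 'rV[R]_m -> 'rV[R]_m) (psi : 'rV[R]_m -> R^o).
Variables (U : set 'rV[R]_p) (F : 'rV[R]_p -> 'rV[R]_m) (e : 'rV[R]_p).
Variable H : 'rV[R]_p -> 'M[R]_p.
Hypothesis GW : local_metric W G.
Hypothesis sG : smooth_on W G.
Hypothesis sxi : smooth_on W xi.
Hypothesis spsi : smooth_on W psi.
Hypothesis conf : forall x, W x -> forall u, covd G id xi x u = psi x *: u.
Hypothesis xi_neq0 : forall x, W x -> xi x != 0.
Hypothesis Uo : open U.
Hypothesis sF : smooth_on U F.
Hypothesis FW : forall y, U y -> W (F y).
Hypothesis Fe : forall y, U y -> 'D_e F y = xi (F y).
Hypothesis HE : forall y, U y -> H y = 'J F y *m G (F y) *m ('J F y)^T.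
Hypothesis Hu : forall y, U y -> H y \in unitmx.

Let nearU x : U x -> \forall y \near x, U y.
Proof. by move=> Ux; exact: open_nbhs_nbhs. Qed.

Let is_derive_F x : U x -> is_derive x e F (xi (F x)).
Proof.
move=> Ux; apply: is_derive_eq (Fe Ux).
by apply/derivableP/diff_derivable; exact: smooth_on_differentiable sF Ux.
Qed.

Let is_derive_DF x a : U x ->
  is_derive x e (fun y => 'D_a F y) ('D_('D_a F x) xi (F x)).
Proof.
move=> Ux; apply: is_derive_eq (derive_flow sxi Uo sF FW Fe a Ux).
apply/derivableP/diff_derivable.
exact: (smooth_on_differentiable (smooth_on_derive a sF) Ux).
Qed.

Lemma pullback_entry y i j : U y ->
  H y i j = inner (G (F y)) ('D_(delta_mx 0 i) F y) ('D_(delta_mx 0 j) F y).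
Proof.
move=> Uy; rewrite -inner_delta (HE Uy) inner_jacobian//.
exact: smooth_on_differentiable sF Uy.
Qed.

Lemma is_derive_pullback x : U x -> is_derive x e H ((2 * psi (F x)) *: H x).
Proof.
move=> Ux; apply/is_derive_mx => i j.
apply: (@near_eq_is_derive _ _ _
  (fun y => inner (G (F y)) ('D_(delta_mx 0 i) F y) ('D_(delta_mx 0 j) F y) : R^o)).
  by apply: filterS (nearU Ux) => y Uy; rewrite pullback_entry.
apply: (is_derive_eq (is_derive_metric_along GW (FW Ux) (is_derive_F Ux)
  (is_derive_DF (delta_mx 0 i) Ux) (is_derive_DF (delta_mx 0 j) Ux))).
rewrite [RHS]mxE (pullback_entry i j Ux).
exact (lie_metric GW conf _ _ (FW Ux)).
Qed.

Lemma is_derive_invmx_pullback x : U x ->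
  is_derive x e (fun y => invmx (H y)) (- (2 * psi (F x)) *: invmx (H x)).
Proof.
move=> Ux; apply: (is_derive_eq (is_derive_invmx (is_derive_pullback Ux) (Hu Ux))).
by rewrite -scalemxAr -scalemxAl mulVmx ?mul1mx ?scaleNr//; exact: Hu.
Qed.

(* V is derivable in the direction e and its covariant derivative is d. *)
Definition is_fcovd (V : 'rV[R]_p -> 'rV[R]_m) x d :=
  is_derive x e V (d - Gamma G (F x) (xi (F x)) (V x)).

Lemma is_fcovdP V x d : is_fcovd V x d -> flow_covd G xi F e V x = d.
Proof. by move=> [_ E]; rewrite /flow_covd E subrK. Qed.

Lemma is_fcovd_derivable V x : derivable V x e ->
  is_fcovd V x (flow_covd G xi F e V x).
Proof. by move=> h; rewrite /is_fcovd /flow_covd addrK; exact: derivableP. Qed.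

Lemma is_fcovdZ c V dc d x : is_derive x e (c : 'rV[R]_p -> R^o) dc ->
  is_fcovd V x d -> is_fcovd (fun y => c y *: V y) x (dc *: V x + c x *: d).
Proof.
move=> hc hV; apply: (is_derive_eq (is_derive_scale hc hV)).
by rewrite GammaZr scalerBr addrA.
Qed.

Lemma is_fcovd_sum (I : finType) (V : I -> 'rV[R]_p -> 'rV[R]_m) d x :
  (forall i, is_fcovd (V i) x (d i)) ->
  is_fcovd (fun y => \sum_i V i y) x (\sum_i d i).
Proof.
move=> hV; apply: (is_derive_eq (is_derive_sumr hV)).
by rewrite Gamma_sumr sumrB.
Qed.

Lemma is_fcovdB V V' d d' x : is_fcovd V x d -> is_fcovd V' x d' ->
  is_fcovd (fun y => V y - V' y) x (d - d').
Proof.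
move=> h h'; apply: (is_derive_eq (is_deriveB h h')).
have GN w : Gamma G (F x) (xi (F x)) (- w) = - Gamma G (F x) (xi (F x)) w.
  by rewrite -scaleN1r GammaZr scaleN1r.
by rewrite GammaDr GN !opprD !opprK !addrA; congr (_ + _); rewrite addrAC.
Qed.

Local Notation S i j := (second_cov G F (delta_mx 0 i) (delta_mx 0 j)).
Local Notation T := (trace_second G F H).
Local Notation V := (mean_curv G F H).

Let dT x := \sum_i \sum_j ((- (2 * psi (F x)) * invmx (H x) i j) *: S i j x
  + invmx (H x) i j *: flow_covd G xi F e (S i j) x).

Let is_fcovd_T x : U x -> is_fcovd T x (dT x).
Proof.
move=> Ux; apply: is_fcovd_sum => i; apply: is_fcovd_sum => j.
apply: is_fcovdZ.
  apply: (is_derive_eq ((is_derive_mx _ _ x e).2 (is_derive_invmx_pullback Ux) i j)).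
  by rewrite mxE.
apply: is_fcovd_derivable.
exact: (derivable_second_cov GW sG sF FW Ux).
Qed.

(** The inverse metric contributes [- 2 psi] and [second_cov] contributes [psi]. The remaining terms
    of [flow_covd_second_cov] vanish: two because [v] is orthogonal to the image of the
    differential, the last by [derive_psi]. *)
Let inner_dT x v : U x ->
  (forall i, inner (G (F x)) ('D_(delta_mx 0 i) F x) v = 0) ->
  inner (G (F x)) v (xi (F x)) = 0 ->
  inner (G (F x)) (dT x) v = - psi (F x) * inner (G (F x)) (T x) v.
Proof.
move=> Ux vF vxi.
have vpsi : 'D_v psi (F x) = 0.
  exact: (derive_psi GW sxi spsi conf (FW Ux) (xi_neq0 (FW Ux)) vxi).
rewrite /dT /trace_second !inner_suml mulr_sumr; apply: eq_bigr => i _.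
rewrite !inner_suml mulr_sumr; apply: eq_bigr => j _.
rewrite innerDl !innerZl.
have E := flow_covd_second_cov GW sG sxi spsi conf Uo sF FW Fe (delta_mx 0 i) (delta_mx 0 j) v Ux.
have aux (P h s q pa fb pb fa pw k : R) : q = P * s + pa * fb + pb * fa - pw * k ->
    fb = 0 -> fa = 0 -> pw = 0 -> - (2 * P) * h * s + h * q = - P * (h * s).
  by move=> -> -> -> ->; ring.
exact (aux _ _ _ _ _ _ _ _ _ _ E (vF j) (vF i) vpsi).
Qed.

(** The mean curvature is the trace minus a combination of the ['D_a F]. By [flow_covd_DF] the
    covariant derivative of that combination is again tangent, hence invisible to the normal vector
    [V x]. *)
Lemma is_fcovd_mean_curv x : U x ->
  exists2 d, is_fcovd V x d & inner (G (F x)) d (V x) =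
    - psi (F x) * inner (G (F x)) (V x) (V x).
Proof.
move=> Ux; have FWx := FW Ux.
have hT := is_fcovd_T Ux.
have dF j : is_fcovd (fun y => 'D_(delta_mx 0 j) F y) x (psi (F x) *: 'D_(delta_mx 0 j) F x).
  rewrite -(flow_covd_DF GW sxi conf Uo sF FW Fe _ Ux).
  by apply: is_fcovd_derivable; have [] := is_derive_DF (delta_mx 0 j) Ux.
(* Coefficients of the tangential part of the trace. Their derivatives multiply tangent vectors, so
   it is enough that these derivatives exist. *)
pose c i j y := invmx (H y) i j * inner (G (F y)) (T y) ('D_(delta_mx 0 i) F y) : R^o.
have dc i j : is_derive x e (c i j) ('D_e (c i j) x).
  apply: derivableP; apply: (@derivableM _ _ (fun y => invmx (H y) i j)
     (fun y => inner (G (F y)) (T y) ('D_(delta_mx 0 i) F y))).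
    by have [h _] := is_derive_invmx_pullback Ux; move/derivable_mxP : h; apply.
  by have [] := is_derive_metric_along GW FWx (is_derive_F Ux) hT (is_derive_DF (delta_mx 0 i) Ux).
have hP := is_fcovd_sum (fun i => is_fcovd_sum (fun j => is_fcovdZ (dc i j) (dF j))).
have hV := is_fcovdZ (is_derive_cst (p%:R^-1 : R^o) x e) (is_fcovdB hT hP).
set d := (X in is_fcovd _ x X) in hV.
have VE y : U y -> p%:R^-1 *: (T y - \sum_i \sum_j c i j y *: 'D_(delta_mx 0 j) F y) = V y.
  move=> Uy; rewrite (mean_curvE Uo sF HE Uy) nprojE -(HE Uy).
  congr (_ *: (_ - _)); apply: eq_bigr => i _; apply: eq_bigr => j _.
  by rewrite !(jacobian_row sF _ Uy).
exists d.
  have nV : \forall y \near x,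
      p%:R^-1 *: (T y - \sum_i \sum_j c i j y *: 'D_(delta_mx 0 j) F y) = V y.
    by apply: filterS (nearU Ux) => y; exact: VE.
  have := near_eq_is_derive nV hV.
  by rewrite /is_fcovd /= (VE x Ux).
have VF u : inner (G (F x)) ('D_u F x) (V x) = 0.
  rewrite (local_metricC GW _ _ FWx) deriveEjacobian; last first.
    exact: smooth_on_differentiable sF Ux.
  exact: (mean_curv_orth Uo sF HE Hu).
have vxi : inner (G (F x)) (V x) (xi (F x)) = 0.
  by rewrite (local_metricC GW _ _ FWx) -(Fe Ux); exact: VF.
have P0 : inner (G (F x)) (\sum_i \sum_j ('D_e (c i j) x *: 'D_(delta_mx 0 j) F x
    + c i j x *: (psi (F x) *: 'D_(delta_mx 0 j) F x))) (V x) = 0.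
  rewrite inner_suml big1// => i _; rewrite inner_suml big1// => j _.
  by rewrite innerDl !innerZl VF !mulr0 addr0.
rewrite (mean_curv_norm GW Uo sF FW HE Hu Ux).
rewrite /d scale0r add0r innerZl innerDl innerNl P0 subr0.
rewrite (inner_dT Ux (fun i => VF _) vxi); exact (mulrCA _ _ _).
Qed.

Lemma mean_curv_flow x : U x ->
  inner (G (F x)) (flow_covd G xi F e V x) (V x) =
    - psi (F x) * inner (G (F x)) (V x) (V x).
Proof. by move=> /is_fcovd_mean_curv[d /is_fcovdP ->]. Qed.

Lemma is_derive_mean_curv_norm x : U x ->
  is_derive x e (fun y => inner (G (F y)) (V y) (V y) : R^o)
    (- (2 * psi (F x)) * inner (G (F x)) (V x) (V x)).
Proof.
move=> Ux; have FWx := FW Ux; have [d hd hV] := is_fcovd_mean_curv Ux.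
apply: (is_derive_eq (is_derive_metric_along GW FWx (is_derive_F Ux) hd hd)).
rewrite (metric_compat GW _ _ _ FWx) !innerDl !innerDr !innerNl !innerNr.
rewrite (local_metricC GW (V x) d FWx) hV; ring.
Qed.

Lemma is_derive_flow_norm x : U x ->
  is_derive x e (fun y => inner (H y) e e : R^o)
    (2 * psi (F x) * inner (H x) e e).
Proof.
move=> Ux; have hc := is_derive_cst e x e.
apply: (is_derive_eq (is_derive_inner (is_derive_pullback Ux) hc hc)).
by rewrite innerZm inner0l inner0r !addr0.
Qed.

(** Against the normal vector [V x], a derivative and its normal part have the same pairing, so
    [mean_curv_flow] gives [psi * |V|^2 = 0]. *)
Lemma parallel_mean_curv_eq0 x : U x -> psi (F x) != 0 ->
  normal_covd G F H V x e = 0 -> inner (G (F x)) (V x) (V x) = 0.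
Proof.
move=> Ux psi0; rewrite /normal_covd (normal_part_nproj HE _ Ux) => N0.
have E : covd G F V x e = flow_covd G xi F e V x.
  have dF : 'd F x e = xi (F x).
    by rewrite -(Fe Ux) deriveE//; exact: smooth_on_differentiable sF Ux.
  exact (congr1 (fun u => 'D_e V x + Gamma G (F x) u (V x)) dF).
have := mean_curv_flow Ux; rewrite -E -(@inner_nproj _ _ _ (G (F x)) ('J F x)); last first.
  by move=> c; rewrite (local_metricC GW _ _ (FW Ux)) (mean_curv_orth Uo sF HE Hu).
rewrite N0 inner0l => /esym/eqP; rewrite mulf_eq0 oppr_eq0 (negbTE psi0) /=.
by move/eqP.
Qed.


End MeanCurvatureFlow.

(** * Gauss formula for composites and invariance under isometries *)

Section Composition.
Variable R : realType.

(* For any symbols G' on the middle space; when G' is the metric induced by I,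
   the first two terms are the second fundamental form of I. *)
Lemma second_cov_comp (q p m : nat) (V : set 'rV[R]_q) (Y : set 'rV[R]_p)
    (P : 'rV[R]_q -> 'rV[R]_p) (I : 'rV[R]_p -> 'rV[R]_m)
    (F : 'rV[R]_q -> 'rV[R]_m) (G : 'rV[R]_m -> 'M[R]_m) (G' : 'rV[R]_p -> 'M[R]_p)
    x a b :
  open V -> smooth_on V P -> (forall y, V y -> Y (P y)) ->
  open Y -> smooth_on Y I -> (forall y, V y -> F y = I (P y)) -> V x ->
  second_cov G F a b x =
  second_cov G I ('D_a P x) ('D_b P x) (P x)
    - 'D_(Gamma G' (P x) ('D_a P x) ('D_b P x)) I (P x)
  + 'D_(second_cov G' P a b x) I (P x).
Proof.
move=> Vo sP PY Yo sI FE Vx.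
have dP y : V y -> differentiable P y by exact: smooth_on_differentiable.
have dI y : Y y -> differentiable I y by exact: smooth_on_differentiable.
have nV y : V y -> \forall z \near y, V z by move=> Vy; exact: open_nbhs_nbhs.
have hP y c : V y -> is_derive y c P ('D_c P y).
  by move=> Vy; exact/derivableP/diff_derivable/dP.
have DF c y : V y -> 'D_c F y = 'D_('D_c P y) I (P y).
  move=> Vy; have E : 'D_c F y = 'D_c (fun z => I (P z)) y.
    by apply: near_eq_derive; apply: filterS (nV y Vy) => z; exact: FE.
  have [_ E'] := is_derive_comp (dI _ (PY y Vy)) (hP y c Vy).
  have D : 'D_('D_c P y) I (P y) = 'd I (P y) ('D_c P y).
    by apply: deriveE; exact: dI (PY y Vy).
  exact (etrans E (etrans E' (esym D))).
have hDP : is_derive x a (fun y => 'D_b P y) ('D_a (fun y => 'D_b P y) x).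
  apply/derivableP/diff_derivable.
  exact: (smooth_on_differentiable (smooth_on_derive b sP) Vx).
have Pc : {for x, continuous P} by apply: differentiable_continuous; exact: dP.
have DDF : 'D_a (fun y => 'D_b F y) x =
    'D_('D_a P x) (fun z => 'D_('D_b P x) I z) (P x)
    + 'D_('D_a (fun y => 'D_b P y) x) I (P x).
  have [_ E] := is_derive_derive Yo sI (PY x Vx) Pc (hP x a Vx) hDP.
  rewrite -E; apply: near_eq_derive.
  by apply: filterS (nV x Vx) => y; exact: DF.
rewrite /second_cov DDF (DF a x Vx) (DF b x Vx) (FE x Vx).
rewrite (deriveDv _ _ (dI _ (PY x Vx))).
have aux (t1 t2 t3 t4 : 'rV[R]_m) : t1 + t4 + t2 = t1 + t2 - t3 + (t4 + t3).
  by rewrite -[_ - t3 + _]addrA [t4 + t3]addrC addKr addrAC.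
exact: aux.
Qed.

(** By [isometric_koszul], the tangential part of the ambient derivative is the intrinsic
    connection. *)
Lemma second_cov_orth (p m : nat) (Y : set 'rV[R]_p) (W : set 'rV[R]_m)
    (I : 'rV[R]_p -> 'rV[R]_m) (G : 'rV[R]_m -> 'M[R]_m) (G' : 'rV[R]_p -> 'M[R]_p)
    z u v w :
  local_metric W G -> local_metric Y G' -> smooth_on Y I ->
  (forall y, Y y -> W (I y)) ->
  (forall y, Y y -> G' y = 'J I y *m G (I y) *m ('J I y)^T) -> Y z ->
  inner (G (I z)) (second_cov G I u v z - 'D_(Gamma G' z u v) I z) ('D_w I z) = 0.
Proof.
move=> GW GY sI IW GE Yz.
have dI : differentiable I z by exact: smooth_on_differentiable sI Yz.
have K := isometric_koszul u v w GW GY sI IW GE Yz.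
rewrite innerDl innerNl; apply/eqP; rewrite subr_eq0; apply/eqP.
apply: (etrans K); rewrite {1}(GE z Yz); exact: inner_jacobian.
Qed.

Lemma jacobian_comp (q p m : nat) (P : 'rV[R]_q -> 'rV[R]_p)
    (I : 'rV[R]_p -> 'rV[R]_m) (F : 'rV[R]_q -> 'rV[R]_m) x :
  differentiable P x -> differentiable I (P x) -> differentiable F x ->
  (\forall y \near x, F y = I (P y)) -> 'J F x = 'J P x *m 'J I (P x).
Proof.
move=> dP dI dF FE; apply/row_matrixP => i.
have dIP : differentiable (fun y => I (P y)) x by exact: differentiable_comp dP dI.
have E := @near_eq_derive _ _ _ F (fun y => I (P y)) x (delta_mx 0 i) FE.
have [_ E'] := is_derive_comp dI (is_derive_diff (delta_mx 0 i) dP).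
rewrite row_mul !rowE -mulmxA -(deriveEjacobian _ dF) E E'.
by rewrite /jacobian mulmxA !mul_rV_lin1.
Qed.

Lemma nproj_mulmx (q p m : nat) (A : 'M[R]_m) (J : 'M[R]_(q, p)) (K : 'M[R]_(p, m)) w :
  nproj A (J *m K) (w *m K) = nproj (K *m A *m K^T) J w *m K.
Proof. by rewrite /nproj mulmxBl trmx_mul !mulmxA. Qed.

Lemma mean_curv_isometry (q m : nat) (U : set 'rV[R]_q) (W W' : set 'rV[R]_m)
    (G G' : 'rV[R]_m -> 'M[R]_m) (tau : 'rV[R]_m -> 'rV[R]_m)
    (F F' : 'rV[R]_q -> 'rV[R]_m) (H : 'rV[R]_q -> 'M[R]_q) x :
  local_metric W G -> local_metric W' G' -> smooth_on W tau ->
  (forall y, W y -> W' (tau y)) ->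
  (forall y, W y -> G y = 'J tau y *m G' (tau y) *m ('J tau y)^T) ->
  open U -> smooth_on U F -> smooth_on U F' -> (forall y, U y -> W (F y)) ->
  (forall y, U y -> F' y = tau (F y)) ->
  (forall y, U y -> H y = 'J F y *m G (F y) *m ('J F y)^T) ->
  (forall y, U y -> H y = 'J F' y *m G' (F' y) *m ('J F' y)^T) -> U x ->
  mean_curv G' F' H x = mean_curv G F H x *m 'J tau (F x).
Proof.
move=> GW GW' st tW GE Uo sF sF' FW FE HE HE' Ux.
have [Wo _ _] := GW.
have Wz := FW x Ux.
have dF : differentiable F x by exact: smooth_on_differentiable sF Ux.
have dF' : differentiable F' x by exact: smooth_on_differentiable sF' Ux.
have dt : differentiable tau (F x) by exact: smooth_on_differentiable st Wz.
have nF : \forall y \near x, F' y = tau (F y).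
  have : \forall y \near x, U y by exact: open_nbhs_nbhs.
  by apply: filterS => y; exact: FE.
have tu : 'J tau (F x) \in unitmx.
  have := local_metric_unit GW Wz; rewrite (GE _ Wz) !unitmx_mul.
  by move=> /andP[/andP[]].
(* Since ['J tau] is invertible, every vector is tangent to the image of [tau]; the second
   fundamental form, being normal, is orthogonal to itself. *)
have S0 u v : second_cov G' tau u v (F x) - 'D_(Gamma G (F x) u v) tau (F x) = 0.
  apply: (posdef_inner0 (A := G' (tau (F x)))).
    by have [_ _ h] := GW'; apply: h; exact: tW.
  set w := second_cov _ _ _ _ _ - _.
  have E : w = 'D_(w *m invmx ('J tau (F x))) tau (F x).
    by rewrite deriveEjacobian// mulmxKV.
  rewrite {2}E; exact (second_cov_orth _ _ _ GW' GW st tW GE Wz).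
have SE i j : second_cov G' F' i j x = second_cov G F i j x *m 'J tau (F x).
  rewrite (second_cov_comp G' G i j Uo sF FW Wo st FE Ux) S0 add0r.
  exact: deriveEjacobian.
have TE : trace_second G' F' H x = trace_second G F H x *m 'J tau (F x).
  rewrite /trace_second mulmx_suml; apply: eq_bigr => i _.
  rewrite mulmx_suml; apply: eq_bigr => j _.
  by rewrite SE scalemxAl.
rewrite (mean_curvE Uo sF' HE' Ux) (mean_curvE Uo sF HE Ux) -scalemxAl.
rewrite TE (jacobian_comp dF dt dF' nF) nproj_mulmx (FE _ Ux).
by rewrite -(GE _ Wz).
Qed.

End Composition.

(** * The slice of the cylinder at time 0 *)

Section Slice.
Variable R : realType.

Lemma derive_slice (n1 n2 : nat) (W : normedModType R) (f : 'rV[R]_(n1 + n2) -> W)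
    (t : 'rV[R]_n1) (a y : 'rV[R]_n2) :
  'D_(row_mx 0 a) f (row_mx t y) = 'D_a (fun z => f (row_mx t z)) y.
Proof.
rewrite /derive (_ : (fun h => _) =
  fun h : R => h^-1 *: (((fun z => f (row_mx t z)) \o shift y) (h *: a) - f (row_mx t y)))//.
by apply: funext => h /=; rewrite scale_row_mx add_row_mx scaler0 add0r.
Qed.

Lemma second_cov_slice (n1 n2 m : nat) (G : 'rV[R]_m -> 'M[R]_m)
    (F : 'rV[R]_(n1 + n2) -> 'rV[R]_m) t a b y :
  second_cov G F (row_mx 0 a) (row_mx 0 b) (row_mx t y) =
  second_cov G (fun z => F (row_mx t z)) a b y.
Proof.
rewrite /second_cov derive_slice.
have E c z : 'D_(row_mx 0 c) F (row_mx t z) = 'D_c (fun z => F (row_mx t z)) z.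
  exact: derive_slice.
have E' : (fun z => 'D_(row_mx 0 b) F (row_mx t z)) = (fun z => 'D_b (fun z => F (row_mx t z)) z).
  by apply: funext => z; exact: E.
exact (congr2 +%R (congr1 (fun g => 'D_a g y) E') (congr2 (Gamma G _) (E a y) (E b y))).
Qed.

(** [w] minus its component along [xi] is orthogonal to [xi], hence in the row space of [J], hence
    orthogonal to itself. *)
Lemma orth_range (p m : nat) (A : 'M[R]_m) (J : 'M[R]_(p, m)) (xi w : 'rV[R]_m) :
  posdef A -> xi != 0 ->
  (forall v, (exists u, u *m J = v) <-> inner A v xi = 0) ->
  (forall u, inner A w (u *m J) = 0) -> exists c, w = c *: xi.
Proof.
move=> Ap xi0 rg wJ; have [As _] := Ap.
have r0 : inner A xi xi != 0.
  by apply: contraNneq xi0 => /(posdef_inner0 Ap) ->.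
pose c := inner A w xi / inner A xi xi; exists c.
have : inner A (w - c *: xi) xi = 0.
  by rewrite innerDl innerNl innerZl /c divfK// subrr.
move=> /rg[u E].
apply/eqP; rewrite -subr_eq0; apply/eqP; apply: (posdef_inner0 Ap).
rewrite -{2}E innerDl innerNl innerZl wJ.
have -> : inner A xi (u *m J) = 0.
  by rewrite (innerC _ _ As); apply/rg; exists u.
by rewrite mulr0 subrr.
Qed.

(* At t = 0 the metric of the cylinder splits, the (d_t, d_t) term of the trace is
   tangent, and the second fundamental form of the leaf is a multiple of xi. *)
Lemma slice_mean_curv (n p m : nat) (U : set 'rV[R]_(1 + n)) (W : set 'rV[R]_m)
    (V : set 'rV[R]_n) (Y : set 'rV[R]_p)
    (F : 'rV[R]_(1 + n) -> 'rV[R]_m) (G : 'rV[R]_m -> 'M[R]_m)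
    (xi : 'rV[R]_m -> 'rV[R]_m) (psi : 'rV[R]_m -> R^o)
    (P : 'rV[R]_n -> 'rV[R]_p) (I : 'rV[R]_p -> 'rV[R]_m) (G' : 'rV[R]_p -> 'M[R]_p)
    (H : 'rV[R]_(1 + n) -> 'M[R]_(1 + n)) (H' : 'rV[R]_n -> 'M[R]_n) x :
  local_metric W G -> smooth_on W xi ->
  (forall x, W x -> forall u, covd G id xi x u = psi x *: u) ->
  (forall x, W x -> xi x != 0) ->
  open U -> smooth_on U F -> (forall y, U y -> W (F y)) ->
  (forall y, U y -> 'D_(row_mx 1%:M 0) F y = xi (F y)) ->
  (forall y, U y -> H y = 'J F y *m G (F y) *m ('J F y)^T) ->
  (forall y, U y -> H y \in unitmx) ->
  local_metric Y G' -> smooth_on Y I -> (forall y, Y y -> W (I y)) ->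
  (forall y, Y y -> G' y = 'J I y *m G (I y) *m ('J I y)^T) ->
  (forall z, Y z -> forall w,
    (exists u, 'd I z u = w) <-> inner (G (I z)) w (xi (I z)) = 0) ->
  open V -> smooth_on V P -> (forall y, V y -> Y (P y)) ->
  (forall y, V y -> H' y = 'J P y *m G' (P y) *m ('J P y)^T) ->
  (forall y, V y -> H' y \in unitmx) ->
  (forall y, V y -> U (row_mx 0 y)) ->
  (forall y, V y -> F (row_mx 0 y) = I (P y)) -> V x ->
  mean_curv G' P H' x = 0 <-> mean_curv G F H (row_mx 0 x) = 0.
Proof.
move=> GW sxi conf xi0 Uo sF FW Fe HE Hu GY sI IW GE rg Vo sP PY HE' Hu' VU FI Vx.
have Ux := VU x Vx; have Yz := PY x Vx.
have FX := FI x Vx.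
have dF : differentiable F (row_mx 0 x) by exact: smooth_on_differentiable sF Ux.
have dP : differentiable P x by exact: smooth_on_differentiable sP Vx.
have [Yo _ _] := GY.
have dI : differentiable I (P x) by exact: smooth_on_differentiable sI Yz.
pose k := xi (I (P x)); pose JI := 'J I (P x); pose JP := 'J P x.
pose A := G (I (P x)).
have Ap : posdef A by have [_ _ h] := GW; exact/h/IW.
have k0 : k != 0 by exact/xi0/IW.
have rg' v : (exists u, u *m JI = v) <-> inner A v k = 0.
  rewrite -(rg _ Yz); split=> -[u E]; exists u; move: E.
    by rewrite /JI /jacobian mul_rV_lin1.
  by rewrite /JI /jacobian mul_rV_lin1.
have kJ u : inner A k (u *m JI) = 0.
  by have [As _] := Ap; rewrite (innerC _ _ As); apply/rg'; exists u.
have JFE c : c *m 'J F (row_mx 0 x) = lsubmx c 0 0 *: k + rsubmx c *m JP *m JI.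
  have Dc : 'D_(row_mx 0 (rsubmx c)) F (row_mx 0 x) = rsubmx c *m JP *m JI.
    have E1 : 'D_(rsubmx c) (fun z => F (row_mx 0 z)) x = 'D_(rsubmx c) (fun z => I (P z)) x.
      apply: near_eq_derive; have : \forall z \near x, V z by exact: open_nbhs_nbhs.
      by apply: filterS => z; exact: FI.
    have [_ E2] := is_derive_comp dI (is_derive_diff (rsubmx c) dP).
    rewrite derive_slice E1 E2 -(deriveE _ dI) deriveEjacobian//; congr (_ *m _).
    by rewrite /JP /jacobian mul_rV_lin1.
  rewrite -deriveEjacobian// -{1}[c]hsubmxK.
  have -> : row_mx (lsubmx c) (rsubmx c) =
      lsubmx c 0 0 *: row_mx 1%:M 0 + row_mx 0 (rsubmx c).
    rewrite scale_row_mx add_row_mx scaler0 add0r addr0; congr row_mx.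
    by rewrite {1}[lsubmx c]mx11_scalar scalemx1.
  rewrite (deriveDv _ _ dF) (deriveZv _ _ dF) (Fe _ Ux) FX -/k Dc; reflexivity.
have JFc : 'J F (row_mx 0 x) = col_mx k (JP *m JI).
  apply/row_matrixP => i; rewrite !rowE JFE -{3}[delta_mx 0 i]hsubmxK.
  rewrite mul_row_col mulmxA; congr (_ + _).
  by rewrite {2}[lsubmx (delta_mx 0 i)]mx11_scalar mul_scalar_mx.
have HX : H (row_mx 0 x) = block_mx (k *m A *m k^T) 0 0 (H' x).
  rewrite (HE _ Ux) FX JFc tr_col_mx mul_col_mx mul_col_row -/A.
  have kB : k *m A *m (JP *m JI)^T = 0.
    apply/rowP => j; rewrite [RHS]mxE.
    have := kJ (delta_mx 0 j *m JP).
    rewrite -[delta_mx 0 j *m JP *m JI]mulmxA /inner [(_ *m (JP *m JI))^T]trmx_mul.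
    by rewrite trmx_delta mulmxA -colE mxE.
  have Bk : JP *m JI *m A *m k^T = 0.
    have [As _] := Ap.
    apply: trmx_inj; rewrite trmx0 -kB [LHS]trmx_mul trmxK.
    by rewrite [(_ *m A)^T]trmx_mul As mulmxA.
  rewrite kB Bk; congr block_mx.
  by rewrite (HE' _ Vx) (GE _ Yz) trmx_mul !mulmxA.
have TE : exists c, trace_second G F H (row_mx 0 x) =
    c *: k + trace_second G' P H' x *m JI.
  suff : exists c, trace_second G F H (row_mx 0 x) - trace_second G' P H' x *m JI = c *: k.
    by move=> [c E]; exists c; rewrite -E subrK.
  (* A vector is a multiple of [xi] once it is orthogonal to the leaf, and this is tested term by
     term on the split trace. *)
  apply: (orth_range Ap k0 rg') => u.
  have Hu0 := Hu _ Ux; rewrite HX in Hu0.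
  pose e : 'rV[R]_(1 + n) := row_mx 1%:M 0.
  pose S i j := second_cov G F (delta_mx 0 i) (delta_mx 0 j) (row_mx 0 x).
  pose S' (i j : 'I_n) := second_cov G' P (delta_mx 0 i) (delta_mx 0 j) x.
  have SR i j : S (rshift 1 i) (rshift 1 j) =
      second_cov G I ('D_(delta_mx 0 i) P x) ('D_(delta_mx 0 j) P x) (P x)
      - 'D_(Gamma G' (P x) ('D_(delta_mx 0 i) P x) ('D_(delta_mx 0 j) P x)) I (P x)
      + S' i j *m JI.
    rewrite /S !delta_mx_rshift second_cov_slice.
    rewrite (second_cov_comp G G' _ _ Vo sP PY Yo sI FI Vx).
    by rewrite [X in _ + X](deriveEjacobian _ dI).
  (* The covariant derivative of [xi] along itself is [psi] times [xi]. *)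
  have SL i j : S (lshift n i) (lshift n j) = psi (I (P x)) *: k.
    rewrite /S !ord1 !delta_mx_lshift.
    have -> : delta_mx 0 0 = 1%:M :> 'rV[R]_1.
      by apply/rowP => l; rewrite !ord1 !mxE.
    have E := flow_covd_DF GW sxi conf Uo sF FW Fe e Ux.
    pose T v := 'D_e (fun z => 'D_e F z) (row_mx 0 x)
      + Gamma G (F (row_mx 0 x)) v ('D_e F (row_mx 0 x)).
    apply: (etrans (congr1 T (Fe _ Ux))); apply: (etrans E).
    by rewrite (Fe _ Ux) FX.
  have -> : trace_second G F H (row_mx 0 x) =
     \sum_(i < 1) \sum_(j < 1) invmx (k *m A *m k^T) i j *: S (lshift n i) (lshift n j)
     + \sum_(i < n) \sum_(j < n) invmx (H' x) i j *: S (rshift 1 i) (rshift 1 j).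
    rewrite /trace_second big_split_ord /=; congr (_ + _).
      apply: eq_bigr => i _; rewrite big_split_ord /= [X in _ + X]big1 ?addr0.
        by apply: eq_bigr => j _; rewrite HX invmx_block_diag// block_mxEul.
      by move=> j _; rewrite HX invmx_block_diag// block_mxEur mxE scale0r.
    apply: eq_bigr => i _; rewrite big_split_ord /= big1 ?add0r.
      by apply: eq_bigr => j _; rewrite HX invmx_block_diag// block_mxEdr.
    by move=> j _; rewrite HX invmx_block_diag// block_mxEdl mxE scale0r.
  have -> : trace_second G' P H' x *m JI =
     \sum_(i < n) \sum_(j < n) invmx (H' x) i j *: (S' i j *m JI).
    rewrite /trace_second mulmx_suml; apply: eq_bigr => i _.
    by rewrite mulmx_suml; apply: eq_bigr => j _; rewrite scalemxAl.
  rewrite -addrA -sumrB innerDl inner_suml big1 ?add0r; last first.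
    move=> i _; rewrite inner_suml big1// => j _.
    by rewrite innerZl SL innerZl kJ !mulr0.
  rewrite inner_suml big1// => i _; rewrite -sumrB inner_suml big1// => j _.
  rewrite -scalerBr innerZl SR addrK -(deriveEjacobian u dI).
  by rewrite (second_cov_orth _ _ _ GW GY sI IW GE Yz) mulr0.
have JIinj (v : 'rV[R]_p) : v *m JI = 0 -> v = 0.
  move=> v0; have [_ _ h] := GY; apply: (posdef_inner0 (h _ Yz)).
  by rewrite (GE _ Yz) -inner_mulmx v0 inner0l.
rewrite (mean_curv_eq0 Vo sP HE' Hu' Vx) (mean_curv_eq0 Uo sF HE Hu Ux).
have [c Tc] := TE; rewrite {}Tc; split=> [[d Td]|[d]].
  exists (row_mx (c%:M) d); rewrite JFE row_mxKl row_mxKr Td /=.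
  by rewrite !mxE eqxx mulr1n.
rewrite JFE => E; exists (rsubmx d).
(* The image of the difference under [JI] is tangent to the leaf and, by [E'], also a multiple of
   [xi], so it is orthogonal to itself. *)
apply/eqP; rewrite -subr_eq0; apply/eqP/JIinj/(posdef_inner0 Ap).
rewrite mulmxBl.
have E' : trace_second G' P H' x *m JI - rsubmx d *m JP *m JI
    = (lsubmx d 0 0 - c) *: k.
  have aux (a t b s : 'rV[R]_m) : a + t = b + s -> t - s = b - a.
    by move=> ats; rewrite -(addKr a t) ats addrA addrK addrC.
  by rewrite scalerBl; exact: aux.
by rewrite {1}E' -mulmxBl innerZl kJ mulr0.
Qed.

End Slice.

(** * Locality, pullback metrics and charts of the cylinder *)

Section Charts.
Variable R : realType.

Lemma near_eq_differentiable (V W : normedModType R) (f g : V -> W) (x : V) :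
  (\forall y \near x, f y = g y) -> differentiable f x -> differentiable g x.
Proof.
move=> fg /diff_locallyP[fc E].
have sc : (fun h : V => h + x) @ (0 : V) --> x.
  by rewrite -[X in _ --> X]add0r; apply: cvgD; [exact: cvg_id|exact: cvg_cst].
have fgx : f x = g x := nbhs_singleton fg.
have Eg : g \o shift x = cst (g x) + 'd f x +o_ 0 id.
  have n0 : \forall h \near (0 : V), f (h + x) = g (h + x) := sc _ fg.
  apply/eqaddoP => e e0; move/eqaddoP : E => /(_ e e0) E.
  apply: filterS2 n0 E => h E1.
  by rewrite -[(g \o shift x - _) h]/(g (h + x) - (g x + 'd f x h)) -E1 -fgx.
by apply/diff_locallyP; rewrite (diff_unique fc Eg).
Qed.

Lemma smooth_on_subset (p : nat) (W : normedModType R) (U V : set 'rV[R]_p)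
    (f : 'rV[R]_p -> W) : V `<=` U -> smooth_on U f -> smooth_on V f.
Proof.
move=> VU sf r; have {sf} := sf r; elim: r f => [|r IH] f /=.
  by move=> h x /VU; exact: h.
by move=> [h1 h2]; split=> [x /VU|v]; [exact: h1|exact/IH/h2].
Qed.

Lemma posdef_pullback (p m : nat) (A : 'M[R]_m) (J : 'M[R]_(p, m)) :
  posdef A -> (forall u : 'rV[R]_p, u *m J = 0 -> u = 0) -> posdef (J *m A *m J^T).
Proof.
move=> [As Ap] Jinj; split; first by rewrite !trmx_mul trmxK As mulmxA.
move=> u u0; rewrite -inner_mulmx; apply: Ap.
by apply: contraNneq u0 => /Jinj ->.
Qed.

Lemma differentiable_pullback (p m : nat) (U : set 'rV[R]_p) (W : set 'rV[R]_m)
    (f : 'rV[R]_p -> 'rV[R]_m) (G : 'rV[R]_m -> 'M[R]_m) (H : 'rV[R]_p -> 'M[R]_p) x :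
  local_metric W G -> open U -> smooth_on U f -> (forall y, U y -> W (f y)) ->
  (forall y, U y -> H y = 'J f y *m G (f y) *m ('J f y)^T) -> U x ->
  differentiable H x.
Proof.
move=> GW Uo sf fW HE Ux.
have df y : U y -> differentiable f y by exact: smooth_on_differentiable.
pose c i j y := inner (G (f y)) ('D_(delta_mx 0 i) f y) ('D_(delta_mx 0 j) f y) : R^o.
have dc i j : differentiable (c i j) x.
  have d1 : differentiable (fun y => G (f y)) x.
    exact: differentiable_comp (df x Ux) (local_metric_diff GW (fW x Ux)).
  have d2 k : differentiable (fun y => 'D_(delta_mx 0 k) f y) x.
    exact: (smooth_on_differentiable (smooth_on_derive _ sf) Ux).
  exact: (differentiable_inner d1 (d2 i) (d2 j)).
have E y : U y -> \sum_i \sum_j c i j y *: delta_mx i j = H y.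
  move=> Uy; rewrite [RHS]matrix_sum_delta; apply: eq_bigr => i _.
  apply: eq_bigr => j _; congr (_ *: _).
  by rewrite /c -inner_jacobian ?inner_delta ?HE//; exact: df.
apply: (@near_eq_differentiable _ _
  (\sum_i \sum_j (fun y => c i j y *: (delta_mx i j : 'M[R]_p)))).
  have : \forall y \near x, U y by exact: open_nbhs_nbhs.
  apply: filterS => y Uy; rewrite -(E y Uy) fct_sumE.
  by apply: eq_bigr => i _; rewrite fct_sumE.
apply: differentiable_sum => i; apply: differentiable_sum => j.
exact: differentiableZl.
Qed.

Lemma open_repdom (m l : nat) (X : atlas_space R m) (Y : atlas_space R l)
    (f : X -> Y) (i : chart X) (j : chart Y) :
  open (ccod i) -> (forall x, ccod i x -> {for x, continuous (cinv i)}) ->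
  (forall x, ccod i x -> {for cinv i x, continuous f}) -> open (cdom j) ->
  open (repdom f i j).
Proof.
move=> io ic fc jo; rewrite openE => x [ix jx]; rewrite /interior.
apply: filterI; first exact: open_nbhs_nbhs.
have nj : nbhs (f (cinv i x)) (cdom j) by exact: open_nbhs_nbhs.
exact: (ic x ix _ (fc x ix _ nj)).
Qed.

Lemma ccod_cylinder (m : nat) (e : R) (X : atlas_space R m) (i : chart X) x :
  ccod (X := cylinder e X) i x <->
  [/\ - e < lsubmx x 0 0, lsubmx x 0 0 < e & ccod i (rsubmx x)].
Proof.
split=> [[[t q] /= [h1 h2 h3] <-]|[h1 h2 [q iq E]]].
  by rewrite row_mxKl row_mxKr mxE eqxx mulr1n; split=> //; exists q.
exists (lsubmx x 0 0, q) => //=; rewrite E -mx11_scalar; exact: hsubmxK.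
Qed.

Lemma rsubmx_continuous (m n : nat) : continuous (fun x : 'rV[R]_(m + n) => rsubmx x).
Proof. by move=> x; apply: differentiable_continuous; exact: differentiable_rsubmx. Qed.

Lemma lsubmx00_continuous (n : nat) : continuous (fun x : 'rV[R]_(1 + n) => lsubmx x 0 0).
Proof.
rewrite (_ : (fun x => _) = fun x : 'rV[R]_(1 + n) => x 0 (lshift n 0)).
  exact: coord_continuous.
by apply: funext => x; rewrite mxE.
Qed.

Lemma open_ccod_cylinder (m : nat) (e : R) (X : atlas_space R m) (i : chart X) :
  open (ccod i) -> open (ccod (X := cylinder e X) i).
Proof.
move=> io; rewrite (_ : ccod _ = (fun x => lsubmx x 0 0) @^-1` [set t | - e < t]
    `&` ((fun x => lsubmx x 0 0) @^-1` [set t | t < e]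
    `&` (fun x => rsubmx x) @^-1` ccod i)).
  apply: openI; first by apply: open_comp => // x _; exact: lsubmx00_continuous.
  apply: openI; first by apply: open_comp => // x _; exact: lsubmx00_continuous.
  by apply: open_comp => // x _; exact: rsubmx_continuous.
apply/seteqP; split=> x /=.
  by move=> /ccod_cylinder[? ? ?].
by move=> [? [? ?]]; apply/ccod_cylinder.
Qed.

Lemma cinv_cylinder_continuous (m : nat) (e : R) (X : atlas_space R m) (i : chart X) x :
  {for rsubmx x, continuous (cinv i)} ->
  {for x, continuous (@cinv R (1 + m) (cylinder e X) i)}.
Proof.
move=> ic.
have cl : (fun y : 'rV[R]_(1 + m) => lsubmx y 0 0) @ x --> lsubmx x 0 0.
  exact: lsubmx00_continuous.
have cr : (fun y : 'rV[R]_(1 + m) => cinv i (rsubmx y)) @ x --> cinv i (rsubmx x).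
  exact: (continuous_comp (@rsubmx_continuous 1 m x) ic).
exact (cvg_pair cl cr).
Qed.

End Charts.

Lemma is_derive0_const_itvoo (R : realType) (f : R -> R) (a b x y : R) :
  (forall t, a < t < b -> is_derive t (1 : R) f 0) ->
  a < x < b -> a < y < b -> f x = f y.
Proof.
move=> df; wlog xy : x y / x <= y => [H xab yab|/andP[ax xb] /andP[ay yb]].
  by case: (leP x y) => [/H|/ltW/H yx]; [exact|exact/esym/yx].
have [t xt|t|c _] := @MVT_segment R f (fun=> 0) x y xy.
- apply: df; move: xt; rewrite in_itv /= => /andP[xt ty].
  by rewrite (lt_trans ax xt) (lt_trans ty yb).
- apply: derivable_within_continuous => {}t; rewrite in_itv /= => /andP[xt ty].
  by have [] // := df t _; rewrite (lt_le_trans ax xt) (le_lt_trans ty yb).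
by rewrite mul0r => /eqP; rewrite subr_eq0 => /eqP.
Qed.

(** * Coordinate domains and metrics on a manifold *)

Section ManifoldCharts.
Variables (R : realType) (m : nat) (X : atlas_space R m).
Hypothesis hX : manifold X.

Lemma cdom_cinv (i : chart X) x : ccod i x -> cdom i (cinv i x).
Proof. by move=> [p ip <-]; rewrite (mfd_cmapK hX). Qed.

Lemma open_repdom_manifold (l : nat) (Y : atlas_space R l) (f : X -> Y)
    (i : chart X) (j : chart Y) :
  (forall p, cdom i p -> {for p, continuous f}) -> open (cdom j) ->
  open (repdom f i j).
Proof.
move=> fc jo; apply: open_repdom => //; first exact: mfd_open_cod.
  by move=> x; exact: mfd_cinv_cont.
by move=> x /cdom_cinv; exact: fc.
Qed.

Lemma riemannian_local_metric (g : metric X) (i : chart X) :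
  riemannian_metric g -> local_metric (ccod i) (g i).
Proof.
move=> hg; split; first exact: mfd_open_cod.
  by move=> x; exact: smooth_on_differentiable (rm_smooth hg i).
by move=> x ix; split; [exact: rm_sym|exact: rm_pos].
Qed.

End ManifoldCharts.

Lemma ccod_rep (R : realType) (m l : nat) (X : atlas_space R m) (Y : atlas_space R l)
    (f : X -> Y) (i : chart X) (j : chart Y) x :
  repdom f i j x -> ccod j (rep f i j x).
Proof. by move=> [_ jx]; exists (f (cinv i x)). Qed.

Lemma immersion_posdef (R : realType) (m l : nat) (X : atlas_space R m)
    (Y : atlas_space R l) (f : X -> Y) (gY : metric Y) (gX : metric X)
    (i : chart X) (j : chart Y) x :
  immersion f -> induced_metric f gY gX -> repdom f i j x ->
  posdef (gY j (rep f i j x)) -> posdef (gX i x).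
Proof.
move=> [_ finj] fg ijx gp; rewrite (fg i j x ijx); apply: posdef_pullback => // u.
by move=> u0; apply: (finj i j x ijx); rewrite -mul_rV_lin1.
Qed.

(** * The flow map in charts and propagation of zeros along flow lines *)

Section FlowMap.
Variables (R : realType) (n N : nat) (Mt : atlas_space R N) (g : metric Mt)
  (xi : vfield Mt) (psi : Mt -> R) (M : atlas_space R n) (f : M -> Mt)
  (D : Mt -> set R) (Psi : R -> Mt -> Mt) (eps : R) (h : metric (cylinder eps M)).
Hypotheses (hMt : manifold Mt) (hg : riemannian_metric g)
  (hxi : closed_conformal g xi psi) (hxi0 : nowhere_vanishing xi)
  (hM : manifold M) (hPsi : flow xi D Psi) (heps : 0 < eps)
  (hD : forall (t : R) (q : M), - eps < t -> t < eps -> D (f q) t).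
Local Notation Phi := (flow_map (eps := eps) Psi f).
Hypotheses (hPhi : immersion Phi) (hh : induced_metric Phi g h).

Let e : 'rV[R]_(1 + n) := row_mx 1%:M 0.

(** Points of [R * M] with time outside the interval lie in no chart, so [cylinder eps M] need not
    satisfy [manifold]; continuity is checked at the points covered by a chart. *)
Lemma open_repdom_flow (i : chart M) (j : chart Mt) :
  open (@repdom R _ _ (cylinder eps M) Mt Phi i j).
Proof.
apply: open_repdom.
- exact/open_ccod_cylinder/mfd_open_cod.
- move=> x /ccod_cylinder[_ _ ix]; apply: cinv_cylinder_continuous.
  exact: mfd_cinv_cont.
- move=> x /ccod_cylinder[h1 h2 ix]; apply: (hPhi.1.1 i); split=> //=.
  exact: cdom_cinv.
- exact: mfd_open_dom.
Qed.

Lemma flow_map_posdef (i : chart M) (j : chart Mt) y :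
  @repdom R _ _ (cylinder eps M) Mt Phi i j y -> posdef (h i y).
Proof.
move=> ijy; apply: (immersion_posdef hPhi hh ijy).
have [_ _ H] := riemannian_local_metric hMt j hg; apply: H.
exact: ccod_rep ijy.
Qed.

(** A step along [e] changes the time coordinate alone, so the difference quotient is that of the
    integral curve through [f q]. *)
Lemma derive_flow_map (i : chart M) (j : chart Mt) y :
  @repdom R _ _ (cylinder eps M) Mt Phi i j y ->
  'D_e (@rep R _ _ (cylinder eps M) Mt Phi i j) y =
  xi j (@rep R _ _ (cylinder eps M) Mt Phi i j y).
Proof.
move=> [/ccod_cylinder[h1 h2 iy] jy].
set t := lsubmx y 0 0; set p := f (cinv i (rsubmx y)).
have [[_ _ _ _ ic] _] := hPsi p.
have [_ /(_ j jy) [_ <-]] := ic t (hD _ h1 h2).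
rewrite /derive (_ : (fun h => _) = fun s : R => s^-1 *:
   (((fun s : R^o => cmap j (Psi s p)) \o shift (t : R^o)) (s *: (1 : R^o))
    - cmap j (Psi t p)))//.
apply: funext => s; congr (_ *: (_ - _)).
have E1 : lsubmx (s *: e + y) 0 0 = s *: (1 : R^o) + t.
  by rewrite linearD linearZ /= row_mxKl /t [LHS]mxE; congr (_ + _); rewrite !mxE.
have E2 : rsubmx (s *: e + y) = rsubmx y.
  by rewrite linearD linearZ /= row_mxKr scaler0 add0r.
by rewrite /= /rep /flow_map /= E1 E2.
Qed.

Lemma flow_map_local (i : chart M) (j : chart Mt) :
  let U := @repdom R _ _ (cylinder eps M) Mt Phi i j in
  let F := @rep R _ _ (cylinder eps M) Mt Phi i j in
  [/\ open U, smooth_on U F, (forall y, U y -> ccod j (F y)),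
      (forall y, U y -> h i y = 'J F y *m g j (F y) *m ('J F y)^T) &
      (forall y, U y -> h i y \in unitmx)].
Proof.
split; first exact: open_repdom_flow.
- exact (hPhi.1.2 i j).
- by move=> y ijy; exact (ccod_rep ijy).
- by move=> y ijy; exact (hh ijy).
- by move=> y /flow_map_posdef/posdef_unit.
Qed.

Lemma conformal_local (j : chart Mt) :
  [/\ smooth_on (ccod j) (g j), smooth_on (ccod j) (xi j),
      smooth_on (ccod j) (fun x => psi (cinv j x) : R^o),
      (forall x, ccod j x -> forall u, covd (g j) id (xi j) x u = psi (cinv j x) *: u) &
      (forall x, ccod j x -> xi j x != 0)].
Proof.
have [[sxi _] spsi cc] := hxi.
by split; [exact: rm_smooth|exact: sxi|exact: spsi|exact: cc|exact: hxi0].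
Qed.

(* |H|^2 does not depend on the chart of the target, which lets the argument move
   along a whole flow line although the line leaves every single chart. *)
Definition mean_norm (i : chart M) (j : chart Mt) (y : 'rV[R]_(1 + n)) : R^o :=
  let F := @rep R _ _ (cylinder eps M) Mt Phi i j in
  inner (g j (F y)) (mean_curv (g j) F (h i) y) (mean_curv (g j) F (h i) y).

Lemma mean_norm_eq0 (i : chart M) (j : chart Mt) y :
  @repdom R _ _ (cylinder eps M) Mt Phi i j y ->
  mean_norm i j y = 0 <->
  mean_curv (g j) (@rep R _ _ (cylinder eps M) Mt Phi i j) (h i) y = 0.
Proof.
move=> ijy; split=> [|V0]; last by rewrite /mean_norm V0 inner0l.
have [_ _ H] := riemannian_local_metric hMt j hg.
by apply: posdef_inner0; apply: H; exact: ccod_rep ijy.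
Qed.

Lemma mean_norm_chart (i : chart M) (j j' : chart Mt) y :
  @repdom R _ _ (cylinder eps M) Mt Phi i j y ->
  @repdom R _ _ (cylinder eps M) Mt Phi i j' y ->
  mean_norm i j y = mean_norm i j' y.
Proof.
move=> ijy ijy'.
have [Uo sF FW HE _] := flow_map_local i j.
have [Uo' sF' FW' HE' _] := flow_map_local i j'.
pose F := @rep R _ _ (cylinder eps M) Mt Phi i j.
pose F' := @rep R _ _ (cylinder eps M) Mt Phi i j'.
pose U := @repdom R _ _ (cylinder eps M) Mt Phi i j.
pose U' := @repdom R _ _ (cylinder eps M) Mt Phi i j'.
pose tau := rep (fun p : Mt => p) j j'.
pose W := repdom (fun p : Mt => p) j j'.
have Wo : open W.
  by apply: open_repdom_manifold => //; [move=> p _; exact: cvg_id|exact: mfd_open_dom].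
have GW : local_metric W (g j).
  have [_ dg pg] := riemannian_local_metric hMt j hg.
  by split=> // x [jx _]; [exact: dg|exact: pg].
have GW' := riemannian_local_metric hMt j' hg.
have st : smooth_on W tau by exact: mfd_trans.
have tW x : W x -> ccod j' (tau x) by exact: ccod_rep.
have GE x : W x -> g j x = 'J tau x *m g j' (tau x) *m ('J tau x)^T.
  by move=> Wx; exact: rm_trans.
have EF z : U z -> cinv j (F z) = Phi (cinv (a := cylinder eps M) i z).
  by move=> [_ jz]; exact: (mfd_cmapK hMt jz).
have FW2 z : (U `&` U') z -> W (F z).
  move=> [Uz [_ jz']]; split; first exact: FW.
  by rewrite (EF z Uz).
have FE z : (U `&` U') z -> F' z = tau (F z).
  by move=> [Uz _]; rewrite /tau /rep (EF z Uz).
have E : mean_curv (g j') F' (h i) y = mean_curv (g j) F (h i) y *m 'J tau (F y).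
  apply: (mean_curv_isometry GW GW' st tW GE (openI Uo Uo')) => //.
  - by apply: smooth_on_subset sF => z [].
  - by apply: smooth_on_subset sF' => z [].
  - by move=> z [Uz _]; exact: HE.
  - by move=> z [_ Uz]; exact: HE'.
have UUy : (U `&` U') y by [].
rewrite /mean_norm -/F -/F' E inner_mulmx (FE y UUy).
by rewrite -(GE _ (FW2 y UUy)).
Qed.

(** The two factors change at the opposite rates [- 2 psi] and [2 psi]. *)
Lemma is_derive_mean_norm (i : chart M) (j : chart Mt) y :
  @repdom R _ _ (cylinder eps M) Mt Phi i j y ->
  is_derive y e (fun z => mean_norm i j z *: (inner (h i z) e e : R^o)) 0.
Proof.
move=> ijy; have [Uo sF FW HE Hu] := flow_map_local i j.
have [sG sxi spsi cc x0] := conformal_local j.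
have GW := riemannian_local_metric hMt j hg.
have Fe := @derive_flow_map i j.
have h1 := is_derive_mean_curv_norm GW sG sxi spsi cc x0 Uo sF FW Fe HE Hu ijy.
have h2 := is_derive_flow_norm GW sxi cc Uo sF FW Fe HE ijy.
apply: (is_derive_eq (is_derive_scale h1 h2)).
have aux (p u r : R) : - (2 * p) * u * r + u * (2 * p * r) = 0 by ring.
exact: aux.
Qed.

Lemma flow_norm_gt0 (i : chart M) (j : chart Mt) y :
  @repdom R _ _ (cylinder eps M) Mt Phi i j y -> 0 < inner (h i y) e e.
Proof.
move=> /flow_map_posdef[_]; apply.
apply/eqP => /(congr1 lsubmx); rewrite row_mxKl linear0 => /matrixP/(_ 0 0)/eqP.
by rewrite !mxE eqxx oner_eq0.
Qed.

Lemma repdom_slice (i : chart M) (j : chart Mt) x t :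
  ccod i x -> - eps < t < eps -> cdom j (Psi t (f (cinv i x))) ->
  @repdom R _ _ (cylinder eps M) Mt Phi i j (row_mx t%:M x).
Proof.
move=> ix /andP[t1 t2] jx.
have tE : lsubmx (row_mx (t%:M : 'rV[R]_1) x) 0 0 = t.
  by rewrite row_mxKl mxE eqxx mulr1n.
split; first by apply/ccod_cylinder; rewrite tE row_mxKr.
by rewrite /= /flow_map /= tE row_mxKr.
Qed.

Lemma mean_norm_flow0 (i : chart M) (j j0 : chart Mt) x t :
  ccod i x -> - eps < t < eps -> cdom j (Psi t (f (cinv i x))) ->
  cdom j0 (Psi 0 (f (cinv i x))) ->
  mean_norm i j (row_mx t%:M x) = 0 <-> mean_norm i j0 (row_mx 0%:M x) = 0.
Proof.
move=> ix te jt j0x; pose q := f (cinv i x).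
have e0 : - eps < 0 < eps by rewrite oppr_lt0 heps.
(* A chart of the target is picked at each time, with no regularity in [s]; [wE] shows that the
   value of [w] does not depend on the choice. *)
pose ch s := projT1 (cid (mfd_cover hMt (Psi s q))).
have chP s : cdom (ch s) (Psi s q) by rewrite /ch; case: cid.
pose Y s : 'rV[R]_(1 + n) := row_mx s%:M x.
have YE s : s *: e + row_mx 0 x = Y s.
  by rewrite scale_row_mx add_row_mx scaler0 addr0 add0r scalemx1.
pose w s : R^o := mean_norm i (ch s) (Y s) *: (inner (h i (Y s)) e e : R^o).
have wE s k : - eps < s < eps -> cdom k (Psi s q) ->
    w s = mean_norm i k (Y s) *: (inner (h i (Y s)) e e : R^o).
  move=> se sk; rewrite /w (@mean_norm_chart i (ch s) k)//; exact: repdom_slice.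
have dw s : - eps < s < eps -> is_derive (s : R^o) (1 : R^o) w 0.
  move=> se; have Us := repdom_slice ix se (chP s).
  have := is_derive_mean_norm Us; rewrite -/(Y s) -(YE s) => /is_derive_line.
  (* For times near [s] the chart [ch s] still contains the flow line, so [w] agrees there with its
     expression in this single chart. *)
  apply: near_eq_is_derive.
  have Yc : {for (s : R^o), continuous (fun b : R^o => b *: e + row_mx 0 x)}.
    apply: cvgD; last exact: cvg_cst.
    by apply: cvgZr_tmp; exact: cvg_id.
  pose U := @repdom R _ _ (cylinder eps M) Mt Phi i (ch s).
  have Uo : open U by exact: open_repdom_flow.
  have nU : \forall b \near (s : R^o), U (b *: e + row_mx 0 x).
    apply: (Yc U); apply: open_nbhs_nbhs; split=> //.
    by rewrite (YE s).
  apply: filterS nU => b; rewrite (YE b) => -[/ccod_cylinder[b1 b2 _] bj].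
  have tE : lsubmx (Y b) 0 0 = b by rewrite row_mxKl mxE eqxx mulr1n.
  rewrite tE in b1 b2; rewrite (wE b (ch s))//; first by rewrite b1.
  by move: bj; rewrite /= /flow_map /= tE row_mxKr.
have wt : w t = w 0.
  exact: (@is_derive0_const_itvoo R w (- eps) eps).
rewrite (wE t j te jt) (wE 0 j0 e0 j0x) in wt.
have r1 := flow_norm_gt0 (repdom_slice ix te jt).
have r2 := flow_norm_gt0 (repdom_slice ix e0 j0x).
split=> z0; move: wt; rewrite z0 scale0r.
  by move=> /esym/eqP; rewrite scaler_eq0 (gt_eqF r2) orbF => /eqP.
by move=> /eqP; rewrite scaler_eq0 (gt_eqF r1) orbF => /eqP.
Qed.

End FlowMap.

(** * Equivalence of the three conditions by reduction to time 0 *)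

Theorem theorem4p1 (R : realType) (n k : nat)
    (Mt : atlas_space R (n + k + 1)) (g : metric Mt)
    (xi : vfield Mt) (psi : Mt -> R)
    (Xi : atlas_space R (n + k)) (iota : Xi -> Mt) (gXi : metric Xi)
    (M : atlas_space R n) (gM : metric M) (phi : M -> Xi)
    (D : Mt -> set R) (Psi : R -> Mt -> Mt)
    (eps : R) (h : metric (cylinder eps M))
    (hMt : manifold Mt) (hg : riemannian_metric g)
    (hxi : closed_conformal g xi psi) (hxi0 : nowhere_vanishing xi)
    (hXi : leaf g xi iota) (hgXi : induced_metric iota g gXi)
    (hM : manifold M) (hMc : compact [set: M]) (hgM : riemannian_metric gM)
    (hphi : isometric_immersion gM gXi phi)
    (hPsi : flow xi D Psi)
    (heps : 0 < eps)
    (hD : forall (t : R) (q : M), - eps < t -> t < eps -> D (iota (phi q)) t)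
    (hPhi : immersion (flow_map (eps := eps) Psi (iota \o phi)))
    (hh : induced_metric (flow_map (eps := eps) Psi (iota \o phi)) g h)
    (hpsi : forall q : M, psi (iota (phi q)) != 0)
    (hcurv : constant_sectional_curvature g \/ ricci_null g xi) :
  (minimal gM gXi phi <->
     minimal h g (flow_map (eps := eps) Psi (iota \o phi))) /\
  (minimal h g (flow_map (eps := eps) Psi (iota \o phi)) <->
     parallel_mean_curvature h g (flow_map (eps := eps) Psi (iota \o phi))).
Proof.
pose f := iota \o phi.
have [hL _ hiota _ hrange] := hXi.1.
have fc (i : chart M) p : cdom i p -> {for p, continuous f}.
  move=> ip; have [j jp] := mfd_cover hL (phi p).
  exact: (continuous_comp (hphi.1.1.1 i p ip) (hiota.1.1 j _ jp)).
have Psi0 p : Psi 0 p = p by have [[]] := hPsi p.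
have e0 : - eps < 0 < eps by rewrite oppr_lt0 heps.
have z1 : 0%:M = 0 :> 'rV[R]_1 by apply/matrixP => a b; rewrite !mxE mul0rn.
pose mc (i : chart M) (j : chart Mt) := mean_curv (g j)
  (@rep R _ _ (cylinder eps M) Mt (flow_map (eps := eps) Psi f) i j) (h i).
pose rd (i : chart M) (j : chart Mt) :=
  @repdom R _ _ (cylinder eps M) Mt (flow_map (eps := eps) Psi f) i j.
have norm0 (i : chart M) (j : chart Mt) y :
  rd i j y -> mean_norm g f Psi h i j y = 0 <-> mc i j y = 0.
  exact (@mean_norm_eq0 _ _ _ _ _ _ _ _ _ h hMt hg i j y).
(* Each point of the cylinder is tied along its flow line to a point at time 0, where the leaf and
   the assumption on [psi] can be used. *)
have flow0 (i : chart M) (j : chart Mt) y : rd i j y -> exists j0, [/\ ccod i (rsubmx y),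
    cdom j0 (f (cinv i (rsubmx y))),
    rd i j0 (row_mx 0%:M (rsubmx y)) &
    mc i j y = 0 <-> mc i j0 (row_mx 0%:M (rsubmx y)) = 0].
  move=> ijy; have [/ccod_cylinder[t1 t2 iy] jy] := ijy.
  have [j0 j0y] := mfd_cover hMt (f (cinv i (rsubmx y))).
  exists j0; have j0y' : cdom j0 (Psi 0 (f (cinv i (rsubmx y)))) by rewrite Psi0.
  have rd0 := repdom_slice iy e0 j0y'.
  have yE : y = row_mx (lsubmx y 0 0)%:M (rsubmx y).
    by rewrite -mx11_scalar hsubmxK.
  have te : - eps < lsubmx y 0 0 < eps by rewrite t1.
  have E := mean_norm_flow0 hMt hg hxi hxi0 hM hPsi heps hD hPhi hh iy te jy j0y'.
  rewrite -yE in E; split; [exact iy|exact j0y|exact rd0|].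
  exact (iff_trans (iff_sym (norm0 _ _ _ ijy)) (iff_trans E (norm0 _ _ _ rd0))).
have slice (i : chart M) (j : chart Xi) (l : chart Mt) x : repdom phi i j x ->
    cdom l (f (cinv i x)) ->
    mean_curv (gXi j) (rep phi i j) (gM i) x = 0 <-> mc i l (row_mx 0%:M x) = 0.
  move=> ijx lx; rewrite z1.
  have [Uo sF FW HE Hu] := flow_map_local hMt hg hM hPhi hh i l.
  have [sG sxi spsi cc x0] := conformal_local hg hxi hxi0 l.
  have GW := riemannian_local_metric hMt l hg.
  have Fe y := @derive_flow_map _ _ _ _ xi _ f D Psi eps hPsi hD i l y.
  pose Y := repdom iota j l; pose I := rep iota j l.
  have sI : smooth_on Y I := hiota.1.2 j l.
  have IW y : Y y -> ccod l (I y) by exact: ccod_rep.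
  have GE y : Y y -> gXi j y = 'J I y *m g l (I y) *m ('J I y)^T by exact: hgXi.
  have Yo : open Y.
    apply: (open_repdom_manifold hL) => //; last exact: mfd_open_dom.
    by move=> p; exact: hiota.1.1.
  have GY : local_metric Y (gXi j).
    split=> // [y Yy|y Yy]; first exact: (differentiable_pullback GW Yo sI IW GE).
    apply: (immersion_posdef hiota hgXi Yy).
    by have [_ _ H] := GW; apply: H; exact: IW.
  (* On [V] both the chart [j] of the leaf and the chart [l] of the ambient manifold apply, so that
     the flow map at time 0 factors through [iota] in coordinates. *)
  pose P := rep phi i j; pose V := repdom phi i j `&` repdom f i l.
  have Vo : open V.
    apply: openI; apply: (open_repdom_manifold hM) => //.
    - by move=> p; exact: hphi.1.1.1.
    - exact: mfd_open_dom.
    - by move=> p; exact: fc.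
    - exact: mfd_open_dom.
  have sP : smooth_on V P.
    by apply: smooth_on_subset (hphi.1.1.2 i j) => y [].
  have PK y : V y -> cinv j (P y) = phi (cinv i y).
    by move=> [[_ jy] _]; exact: (mfd_cmapK hL jy).
  have PY y : V y -> Y (P y).
    move=> Vy; split; first by case: Vy => /ccod_rep.
    by rewrite (PK y Vy); case: Vy => _ [].
  have HE' y : V y -> gM i y = 'J P y *m gXi j (P y) *m ('J P y)^T.
    by move=> [ijy _]; exact: hphi.2.
  have Hu' y : V y -> gM i y \in unitmx.
    move=> [[iy _] _]; have [_ _ H] := riemannian_local_metric hM i hgM.
    exact/posdef_unit/H.
  have VU y : V y -> rd i l (row_mx 0 y).
    move=> [_ [iy ly]]; rewrite -z1; apply: (repdom_slice iy e0).
    by rewrite Psi0.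
  have FI y : V y -> @rep R _ _ (cylinder eps M) Mt (flow_map (eps := eps) Psi f) i l
      (row_mx 0 y) = I (P y).
    move=> Vy; rewrite /I /rep (PK y Vy) /flow_map /= row_mxKl row_mxKr mxE.
    by rewrite Psi0.
  have Vx : V x by split=> //; case: ijx.
  exact (slice_mean_curv GW sxi cc x0 Uo sF FW Fe HE Hu GY sI IW GE (hrange j l)
    Vo sP PY HE' Hu' VU FI Vx).
split; split.
- move=> H i l y ily; have [l0 [iy l0y _ ->]] := flow0 i l y ily.
  have [j jy] := mfd_cover hL (phi (@cinv R n M i (rsubmx y))).
  have ijy : repdom phi i j (rsubmx y) by [].
  by apply/(slice i j l0 _ ijy l0y); exact: H.
- move=> H i j x ijx; have [l lx] := mfd_cover hMt (f (cinv i x)).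
  apply/(slice i j l x ijx lx); apply: H.
  by case: ijx => ix _; apply: (repdom_slice ix e0); rewrite Psi0.
- move=> H i l y ily u.
  have [Uo sF FW HE Hu] := flow_map_local hMt hg hM hPhi hh i l.
  (* The mean curvature vanishes on a whole neighbourhood of [y], hence so does its derivative. *)
  have V0 : 'D_u (mc i l) y = 0.
    have h0 : \forall z \near y, cst 0 z = mc i l z.
      have : \forall z \near y, rd i l z by exact: open_nbhs_nbhs.
      by apply: filterS => z /H.
    by have [_ ->] := near_eq_is_derive h0 (is_derive_cst 0 y u).
  have C : covd (g l) (@rep R _ _ (cylinder eps M) Mt (flow_map (eps := eps) Psi f) i l)
      (mc i l) y u = 0.
    by rewrite /covd V0 add0r [mc i l y](H i l y ily) Gamma_0r.
  apply: (etrans (normal_part_nproj HE _ ily)).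
  apply: (etrans (congr1 (nproj _ _) C)).
  by rewrite /nproj !mul0mx subr0.
- move=> H i l y ily; have [l0 [iy l0y rd0 ->]] := flow0 i l y ily.
  have [Uo sF FW HE Hu] := flow_map_local hMt hg hM hPhi hh i l0.
  have [sG sxi spsi cc x0] := conformal_local hg hxi hxi0 l0.
  have GW := riemannian_local_metric hMt l0 hg.
  have Fe z := @derive_flow_map _ _ _ _ xi _ f D Psi eps hPsi hD i l0 z.
  (* Parallelism in the direction of the flow, taken at time 0, where [psi] is nonzero by
     assumption. *)
  have N0 := H i l0 _ rd0 (row_mx 1%:M 0).
  apply/(norm0 _ _ _ rd0).
  have cF : cinv l0 (@rep R _ _ (cylinder eps M) Mt (flow_map (eps := eps) Psi f) i l0
      (row_mx 0%:M (rsubmx y))) = f (@cinv R n M i (rsubmx y)).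
    rewrite /rep (mfd_cmapK hMt rd0.2) /flow_map /= row_mxKl row_mxKr mxE.
    by rewrite mul0rn Psi0.
  have p0 : psi (cinv l0 (@rep R _ _ (cylinder eps M) Mt (flow_map (eps := eps) Psi f) i l0
      (row_mx 0%:M (rsubmx y)))) != 0 by rewrite cF; exact: hpsi.
  exact (parallel_mean_curv_eq0 GW sG sxi spsi cc x0 Uo sF FW Fe HE Hu rd0 p0 N0).
Qed.
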